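(* Let $g:\mathbb{R}\to\mathbb{R}$ be smooth, $2\pi$-periodic and positive, and fix $k_y>0$. As $c_x\to\infty$, the wavenumbers $K_x(k_y,c_x)$ converge to a limit independent of $k_y$, namely the harmonic average of $g$: $$\lim_{c_x\to\infty}K_x(k_y,c_x)=k_{x,0}:=\left(\frac{1}{2\pi}\int_0^{2\pi}\frac{dv}{g(v)}\right)^{-1}.$$ Moreover, writing $\varphi(x,\zeta;c_x)$ for the corresponding solution of the stripe-growth system that is strictly increasing in $\zeta$, the $2\pi$-periodic functions $\zeta\mapsto\varphi(0,\zeta;c_x)-\zeta$ converge in $H^1_{\mathrm{per}}$ as $c_x\to\infty$ to $\psi_0(\zeta)-\zeta$, where $\psi_0$ is the solution of $$k_{x,0}\,\psi_0'(\zeta)=g(\psi_0(\zeta)),\qquad \psi_0(\zeta+2\pi)=\psi_0(\zeta)+2\pi,$$ normalized by $\int_0^{2\pi}(\psi_0(\zeta)-\zeta)\,d\zeta=0$.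
   Context: For parameters $c_x\ge0$, $k_y>0$, the stripe-growth system for a real function $\varphi(x,\zeta)$, $x\le0$, $\zeta\in\mathbb{R}$, and a real number $k_x$ is \begin{align*} 0&=\varphi_{xx}+k_y^2\varphi_{\zeta\zeta}+c_x\varphi_x-k_xc_x\varphi_\zeta, && x<0,\ \zeta\in\mathbb{R},\\ 0&=\varphi(x,\zeta+2\pi)-\varphi(x,\zeta)-2\pi, && x\le 0,\ \zeta\in\mathbb{R},\\ 0&=\varphi_x-g(\varphi), && x=0,\ \zeta\in\mathbb{R},\\ 0&=\lim_{x\to-\infty}|\varphi(x,\zeta)-(k_xx+\zeta)|, && \zeta\in\mathbb{R}. \end{align*} $K_x(k_y,c_x)$ denotes the value of $k_x$ for which this system has a (classical) solution that is strictly increasing in $\zeta$; such a solution exists for all $c_x\ge0$, $k_y>0$, and is unique within the class of monotone solutions up to translation in $\zeta$ (the last condition in the system fixes the translation, and for $c_x>0$ it makes $\varphi(0,\zeta)-\zeta$ have mean zero over a period). $H^1_{\mathrm{per}}$ is the Sobolev space of $2\pi$-periodic functions with one derivative in $L^2(0,2\pi)$. *)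

(* Defs.v *)
From HB Require Import structures.
From mathcomp Require Import all_boot all_order all_algebra.
From mathcomp Require Import all_classical all_reals all_analysis.

Set Implicit Arguments.
Unset Strict Implicit.
Unset Printing Implicit Defensive.

Import Order.TTheory GRing.Theory Num.Theory.
Import numFieldNormedType.Exports.

Local Open Scope classical_set_scope.
Local Open Scope ring_scope.

Definition smooth (R : realType) (f : R -> R) : Prop :=
  forall (n : nat) (x : R), derivable (derive1n n f) x 1.

(** ** Functions of (x, zeta) on the half-plane x <= 0

    They are represented by [phi : R -> R -> R], first argument x, second
    argument zeta; the values of [phi] at x > 0 are never used. *)

Section HalfPlane.
Variable R : realType.
Implicit Types (phi : R -> R -> R) (x z : R).

(** Partial derivatives. The x-derivative is taken relative to the half-line
    x <= 0: it is the usual derivative if x < 0, and the left derivative if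
    x = 0. *)

Definition quotient_x phi x z : R -> R :=
  fun y => (phi y z - phi x z) / (y - x).

Definition derivable_x phi x z : Prop :=
  cvg (quotient_x phi x z y @[y --> within [set y | y <= 0] x^']).

Definition dx phi x z : R :=
  lim (quotient_x phi x z y @[y --> within [set y | y <= 0] x^']).

Definition derivable_z phi x z : Prop := derivable (phi x) z 1.

Definition dz phi x z : R := derive1 (phi x) z.

Definition C0_on (D : set R) phi : Prop :=
  {within D `*` [set: R], continuous (fun p : R * R => phi p.1 p.2)}.

Definition C1_on (D : set R) phi : Prop :=
  [/\ C0_on D phi,
      forall x z, D x -> derivable_x phi x z /\ derivable_z phi x z,
      C0_on D (dx phi) &
      C0_on D (dz phi)].

(** C^2 in the open half-plane, and C^1 up to the boundary x = 0. *)
Definition classical phi : Prop :=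
  [/\ C1_on [set x | x <= 0] phi,
      C1_on [set x | x < 0] (dx phi) &
      C1_on [set x | x < 0] (dz phi)].

Definition stripe_growth (g : R -> R) (ky cx kx : R) phi : Prop :=
  [/\ forall x z, x < 0 ->
        0 = dx (dx phi) x z + ky ^+ 2 * dz (dz phi) x z
            + cx * dx phi x z - kx * cx * dz phi x z,
      forall x z, x <= 0 -> 0 = phi x (z + 2 * pi) - phi x z - 2 * pi,
      forall z, 0 = dx phi 0 z - g (phi 0 z) &
      forall z, `|phi x z - (kx * x + z)| @[x --> -oo] --> (0 : R)].

Definition monotone_solution (g : R -> R) (ky cx kx : R) phi : Prop :=
  [/\ classical phi,
      stripe_growth g ky cx kx phi &
      forall x z1 z2, x <= 0 -> z1 < z2 -> phi x z1 < phi x z2].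

End HalfPlane.

(** ** The Sobolev space H^1_per of 2 pi-periodic functions *)

Section H1per.
Variable R : realType.
Local Notation mu := (@lebesgue_measure R).
Implicit Types f h : R -> R.

(** The square of the norm of L^2(0, 2 pi). *)
Definition sqnormL2 f : \bar R :=
  (\int[mu]_(x in `[0%R, (2 * pi)%R]) ((f x) ^+ 2)%:E)%E.

Definition inL2 f : Prop :=
  measurable_fun `[0%R, (2 * pi)%R] f /\ (sqnormL2 f < +oo)%E.

(** [h] is the weak derivative of [f], tested against smooth periodic
    functions. *)
Definition weak_derivative f h : Prop :=
  forall eta : R -> R, smooth eta -> periodic eta (2 * pi) ->
    \int[mu]_(x in `[0%R, (2 * pi)%R]) (f x * derive1 eta x)
    = - \int[mu]_(x in `[0%R, (2 * pi)%R]) (h x * eta x).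

(** [f] belongs to H^1_per and has weak derivative [h]. *)
Definition H1per_with f h : Prop :=
  [/\ periodic f (2 * pi), inL2 f, inL2 h & weak_derivative f h].

(** Convergence of [f c] to [f0] in H^1_per as c -> +oo. Weak derivatives are
    unique up to null sets, so the choice of [h] and [h0] is immaterial. *)
Definition cvg_H1per (f : R -> R -> R) f0 : Prop :=
  exists (h : R -> R -> R) (h0 : R -> R),
    [/\ \forall c \near +oo, H1per_with (f c) (h c),
        H1per_with f0 h0 &
        (sqnormL2 (fun z => f c z - f0 z)%R
         + sqnormL2 (fun z => h c z - h0 z)%R)%E @[c --> +oo] --> 0%E].

End H1per.

Definition harmonic_average (R : realType) (g : R -> R) : R :=
  ((2 * pi)^-1 *
   \int[lebesgue_measure]_(v in `[0%R, (2 * pi)%R]) (g v)^-1)^-1.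

Definition limit_profile (R : realType) (g : R -> R) (psi : R -> R) : Prop :=
  [/\ forall z, derivable psi z 1,
      forall z, harmonic_average g * derive1 psi z = g (psi z),
      forall z, psi (z + 2 * pi) = psi z + 2 * pi &
      \int[lebesgue_measure]_(z in `[0%R, (2 * pi)%R]) (psi z - z) = 0].

(* Main.v *)
(* Subtracting the travelling plane k x + zeta leaves u, 2 pi-periodic in zeta
   and vanishing at x = -oo. Its n-th Fourier mode Z satisfies
   Z'' + c Z' = (ky^2 n^2 + i k c n) Z, so Z' = nu_n Z where nu_n is the root of
   nu^2 + c nu = ky^2 n^2 + i k c n with nonnegative real part. At x = 0 this is
   a Dirichlet-to-Neumann relation between psi = phi(0, .) and
   u_x = g(psi) - k. As c -> oo, nu_n -> i k n, hence the residual
   r = g(psi) - k psi' should vanish; its modes are (nu_n - i k n) / nu_n times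
   those of g(psi) - k, the ratio being O(min(1, n / c)). Since psi is increasing
   with psi(zeta + 2 pi) = psi(zeta) + 2 pi, g(psi) has bounded variation and its
   modes are O(1 / n). Summation gives |r|^2 = O(1 / c) in L^2, through a
   Parseval-type inequality obtained from the Fejer kernel. Finally, if
   G' = 1 / g, then G(psi)' = (1 - r / g(psi)) / k: integrating over a period
   gives k -> k_{x,0}, and inverting G gives uniform convergence of psi to psi_0,
   the translation being fixed by the zero mean; L^2 convergence of the
   derivatives follows from k psi' = g(psi) - r. *)

(* Uniformly in [c], the derivative of [psi] is controlled only in [L^1]: it is nonnegative with
   integral [2 pi] over a period. This is why the argument runs mode by mode. The second root of the
   dispersion relation has real part at most [- c], so its exponential blows up at -oo and decay
   excludes it. That decay is given only pointwise in zeta; monotonicity makes it uniform over a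
   period. Since [phi] is C^2 only for x < 0 and C^1 up to x = 0, the mode relation is proved inside
   and carried to the boundary by continuity of [u] and [u_x]. Both regimes of the ratio are merged
   into one bound O(n / (n + c)), so the modes of [r] have energy O((n + c)^-2), and their sum
   telescopes to O(1 / c). Mode 0 says that [k] is the mean of g(psi), hence lies between min g and
   max g; every constant then depends only on [ky], these two bounds and max |g'|. The squared
   errors of the wavenumber and of the profile in H^1 are thus O(1 / c). A complex mode Z = A - i B
   is carried as the pair of its cosine and sine coefficients. *)
Require Import Defs.
From HB Require Import structures.
From mathcomp Require Import all_boot all_order all_algebra.
From mathcomp Require Import all_classical all_reals all_analysis.
From mathcomp Require Import ring lra.

Set Implicit Arguments.
Unset Strict Implicit.
Unset Printing Implicit Defensive.

Import Order.TTheory GRing.Theory Num.Theory.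
Import numFieldNormedType.Exports.

Local Open Scope classical_set_scope.
Local Open Scope ring_scope.

(** * Derivatives and integrals of continuous functions *)

Section Pointwise.
Variable R : realType.
Implicit Types (f g : R -> R) (x a b d e : R).

(* [is_derive] is a type class; this copy keeps instance resolution from
   choosing the shape of derivatives. *)
Definition has_deriv f x d : Prop := is_derive x 1 f d.

Lemma has_deriv_eq f x d e : has_deriv f x d -> d = e -> has_deriv f x e.
Proof. by move=> fd <-. Qed.

Lemma der_cst a x : has_deriv (fun=> a) x 0.
Proof. exact: is_derive_cst. Qed.

Lemma der_id x : has_deriv (fun y : R => y) x 1.
Proof. exact: is_derive_id. Qed.

Lemma derD f g x d e : has_deriv f x d -> has_deriv g x e ->
  has_deriv (fun y => f y + g y) x (d + e).
Proof. move=> fd ge; exact: (@is_deriveD _ _ _ f g). Qed.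

Lemma derN f x d : has_deriv f x d -> has_deriv (fun y => - f y) x (- d).
Proof. move=> fd; exact: (@is_deriveN _ _ _ f). Qed.

Lemma derM f g x d e : has_deriv f x d -> has_deriv g x e ->
  has_deriv (fun y => f y * g y) x (f x * e + g x * d).
Proof. move=> fd ge; exact: (@is_deriveM _ _ f g). Qed.

Lemma derV f x d : f x != 0 -> has_deriv f x d ->
  has_deriv (fun y => (f y)^-1) x (- (f x) ^- 2 * d).
Proof. by move=> fx0 fd; exact: is_deriveV. Qed.

Lemma der_comp f g x d e : has_deriv f (g x) d -> has_deriv g x e ->
  has_deriv (fun y => f (g y)) x (d * e).
Proof. move=> fd ge; exact: (@is_derive1_comp _ f g). Qed.

Lemma der_sqr f x d : has_deriv f x d ->
  has_deriv (fun y => f y ^+ 2) x (2 * f x * d).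
Proof.
move=> fd; rewrite (_ : (fun y => _) = (fun y => f y * f y)); last first.
  by apply/funext => y; rewrite expr2.
by apply: has_deriv_eq (derM fd fd) _; ring.
Qed.

Lemma der_cos f x d : has_deriv f x d ->
  has_deriv (fun y => cos (f y)) x (- sin (f x) * d).
Proof. by move=> fd; apply: der_comp fd; exact: is_derive_cos. Qed.

Lemma der_sin f x d : has_deriv f x d ->
  has_deriv (fun y => sin (f y)) x (cos (f x) * d).
Proof. by move=> fd; apply: der_comp fd; exact: is_derive_sin. Qed.

Lemma der_continuous_at f x d : has_deriv f x d -> {for x, continuous f}.
Proof.
by move=> [fd _]; exact/differentiable_continuous/derivable1_diffP.
Qed.

Lemma der_continuous f (df : R -> R) :
  (forall x : R, has_deriv f x (df x)) -> continuous f.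
Proof. by move=> fd x; exact: der_continuous_at (fd x). Qed.

Lemma cont_cst a : continuous ((fun=> a) : R -> R).
Proof. by move=> x; exact: cvg_cst. Qed.

Lemma cont_id : continuous ((fun x => x) : R -> R).
Proof. by move=> x; exact: cvg_id. Qed.

Lemma contD f g : continuous f -> continuous g ->
  continuous (fun x => f x + g x).
Proof. by move=> cf cg x; apply: cvgD; [exact: cf|exact: cg]. Qed.

Lemma contN f : continuous f -> continuous (fun x => - f x).
Proof. by move=> cf x; apply: cvgN; exact: cf. Qed.

Lemma contM f g : continuous f -> continuous g ->
  continuous (fun x => f x * g x).
Proof. by move=> cf cg x; apply: cvgM; [exact: cf|exact: cg]. Qed.

Lemma contX f n : continuous f -> continuous (fun x => f x ^+ n).
Proof.
move=> cf x; have := @exprn_continuous R n (f x).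
by move=> /(continuous_comp (cf x)).
Qed.

Lemma contV f : (forall x, f x != 0) -> continuous f ->
  continuous (fun x => (f x)^-1).
Proof. by move=> f0 cf x; apply: cvgV => //; exact: cf. Qed.

Lemma cont_norm f : continuous f -> continuous (fun x => `|f x|).
Proof. by move=> cf x; apply: cvg_norm; exact: cf. Qed.

Lemma cont_comp f g : continuous f -> continuous g ->
  continuous (fun x => f (g x)).
Proof. by move=> cf cg x; apply: continuous_comp; [exact: cg|exact: cf]. Qed.

Lemma cont_cos f : continuous f -> continuous (fun x => cos (f x)).
Proof. by apply: cont_comp; exact: continuous_cos. Qed.

Lemma cont_sin f : continuous f -> continuous (fun x => sin (f x)).
Proof. by apply: cont_comp; exact: continuous_sin. Qed.

Lemma cont_sum (n : nat) (F : nat -> R -> R) :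
  (forall i, continuous (F i)) -> continuous (fun x => \sum_(i < n) F i x).
Proof.
move=> cF; elim: n => [|n IHn].
  rewrite (_ : (fun x => _) = (fun=> 0)); first exact: cont_cst.
  by apply/funext => x; rewrite big_ord0.
rewrite (_ : (fun x => _) = (fun x => \sum_(i < n) F i x + F n x)).
  exact: contD.
by apply/funext => x; rewrite big_ord_recr.
Qed.

End Pointwise.

Ltac cont_step F :=
  lazymatch F with
  | (fun=> ?a) => apply: cont_cst
  | (fun x => x) => apply: cont_id
  | (fun x => @?f x + @?g x) => apply: contD
  | (fun x => - @?f x) => apply: contN
  | (fun x => @?f x * @?g x) => apply: contM
  | (fun x => @?f x ^+ _) => apply: contX
  | (fun x => `|@?f x|) => apply: cont_norm
  | (fun x => cos (@?f x)) => apply: cont_cos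
  | (fun x => sin (@?f x)) => apply: cont_sin
  | GRing.mul _ => apply: contM
  | GRing.add _ => apply: contD
  | GRing.opp => apply: contN
  | _ => first [assumption | apply: continuous_cos | apply: continuous_sin | apply: cont_id]
  end.

Ltac cont := repeat
  match goal with |- forall x, continuous_at x ?F => cont_step F end.

Ltac der := repeat first
  [ eassumption | apply: der_cst | apply: der_id
  | apply: der_cos | apply: der_sin | apply: der_sqr
  | apply: derD | apply: derN | apply: derM ].

Section SegmentIntegral.
Variable R : realType.
Implicit Types (f g : R -> R) (a b c : R).

Definition segint a b f : R := \int[lebesgue_measure]_(x in `[a, b]) f x.

Lemma continuous_integrable a b f : continuous f ->
  (@lebesgue_measure R).-integrable `[a, b] (EFin \o f).
Proof.
move=> cf; apply: continuous_compact_integrable; first exact: segment_compact.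
exact: continuous_subspaceT.
Qed.

Lemma eq_segint a b f g : (forall x, a <= x <= b -> f x = g x) ->
  segint a b f = segint a b g.
Proof.
move=> fg; apply: eq_Rintegral => x; rewrite inE/= in_itv/=; exact: fg.
Qed.

Lemma segintD a b f g : continuous f -> continuous g ->
  segint a b (fun x => f x + g x) = segint a b f + segint a b g.
Proof. by move=> cf cg; apply: RintegralD => //; exact: continuous_integrable. Qed.

Lemma segintZ a b c f : continuous f ->
  segint a b (fun x => c * f x) = c * segint a b f.
Proof. by move=> cf; apply: RintegralZl => //; exact: continuous_integrable. Qed.

Lemma segintN a b f : continuous f ->
  segint a b (fun x => - f x) = - segint a b f.
Proof.
move=> cf; rewrite -[RHS]mulN1r -segintZ//.
by apply: eq_segint => x _; rewrite mulN1r.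
Qed.

Lemma segintB a b f g : continuous f -> continuous g ->
  segint a b (fun x => f x - g x) = segint a b f - segint a b g.
Proof. by move=> cf cg; rewrite segintD ?segintN//; cont. Qed.

Lemma le_segint a b f g : continuous f -> continuous g ->
  (forall x, a <= x <= b -> f x <= g x) -> segint a b f <= segint a b g.
Proof.
move=> cf cg fg; apply: le_Rintegral => //; try exact: continuous_integrable.
Qed.

Lemma segint_cst a b c : a <= b -> segint a b (fun=> c) = c * (b - a).
Proof.
move=> ab; rewrite /segint Rintegral_cst//; congr (_ * _).
rewrite [X in fine X](lebesgue_measure_itv `[a, b]) /= lte_fin.
case: ltP => [//|ba]; have -> : a = b by apply/eqP; rewrite eq_le ab ba.
by rewrite subrr.
Qed.

Lemma segint_ge0 a b f : (forall x, a <= x <= b -> 0 <= f x) ->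
  0 <= segint a b f.
Proof. by move=> f0; apply: Rintegral_ge0 => x /=; rewrite in_itv/=; exact: f0. Qed.

Lemma ler_norm_segint a b f : continuous f ->
  `|segint a b f| <= segint a b (fun x => `|f x|).
Proof. by move=> cf; apply: le_normr_Rintegral => //; exact: continuous_integrable. Qed.

Lemma ler_norm_segint_cst a b f c : a <= b -> continuous f ->
  (forall x, a <= x <= b -> `|f x| <= c) -> `|segint a b f| <= c * (b - a).
Proof.
move=> ab cf fc; apply: (le_trans (ler_norm_segint _ _ cf)).
by rewrite -segint_cst//; apply: le_segint => //; cont.
Qed.

Lemma segint_FTC a b (F : R -> R) f : a <= b -> continuous f ->
  (forall x : R, has_deriv F x (f x)) -> segint a b f = F b - F a.
Proof.
move=> ab cf Ff; have cF : continuous F by apply: der_continuous Ff.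
move: ab; rewrite le_eqVlt => /predU1P[<-|ab].
  by rewrite subrr /segint set_itv1 Rintegral_set1.
rewrite /segint /Rintegral (@continuous_FTC2 _ f F a b ab)//.
- exact: continuous_subspaceT.
- split; last 2 first.
  + by apply: cvg_at_right_filter; exact: cF.
  + by apply: cvg_at_left_filter; exact: cF.
  by move=> x _; have [] := Ff x.
- by move=> x _; rewrite derive1E; have [_ ->] := Ff x.
Qed.

Lemma segint_by_parts a b f g (df dg : R -> R) : a <= b ->
  continuous df -> continuous dg ->
  (forall x : R, has_deriv f x (df x)) -> (forall x : R, has_deriv g x (dg x)) ->
  segint a b (fun x => f x * dg x) =
  f b * g b - f a * g a - segint a b (fun x => df x * g x).
Proof.
move=> ab cdf cdg fd gd.
have cf : continuous f by apply: der_continuous fd.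
have cg : continuous g by apply: der_continuous gd.
apply/eqP; rewrite -subr_eq opprK -segintD; [|cont|cont]; apply/eqP.
apply: (@segint_FTC a b (fun x => f x * g x)) => //; first by cont.
by move=> x; apply: has_deriv_eq (derM (fd x) (gd x)) _; ring.
Qed.

Lemma segint_sum a b n (F : nat -> R -> R) : (forall i, continuous (F i)) ->
  segint a b (fun x => \sum_(i < n) F i x) = \sum_(i < n) segint a b (F i).
Proof.
move=> cF; elim: n => [|n IHn].
  rewrite big_ord0 -[RHS](mul0r (segint a b (fun=> 0))) -segintZ; last by cont.
  by apply: eq_segint => x _; rewrite big_ord0 mul0r.
rewrite big_ord_recr/= -IHn -segintD//; last exact: cont_sum.
by apply: eq_segint => x _; rewrite big_ord_recr.
Qed.

(** Young's inequality [|y| <= c * y ^+ 2 + (4 * c)^-1], integrated. The free parameter [c] later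
    yields Cauchy-Schwarz. *)
Lemma segint_sqr_le a b f c : a <= b -> continuous f -> 0 < c ->
  segint a b (fun x => `|f x|) <=
    c * segint a b (fun x => f x ^+ 2) + (b - a) / (4 * c).
Proof.
move=> ab cf c0.
have -> : (b - a) / (4 * c) = segint a b (fun=> (4 * c)^-1).
  by rewrite segint_cst// mulrC.
rewrite -segintZ; last by cont.
rewrite -segintD; [|cont|cont].
apply: le_segint; [cont|cont|] => x _.
rewrite -[f x ^+ 2]real_normK ?num_real//; set y := `|f x|.
have : 0 <= c * (y - (2 * c)^-1) ^+ 2 by rewrite mulr_ge0 ?sqr_ge0 ?ltW.
rewrite (_ : c * _ = c * y ^+ 2 - y + (4 * c)^-1); first by lra.
by field; rewrite gt_eqF.
Qed.

End SegmentIntegral.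

(** * Fourier coefficients and the Fejer kernel *)

Section Fourier.
Variable R : realType.
Implicit Types (f g : R -> R) (w t : R) (n N : nat).

Let tau : R := 2 * pi.

Let tau_ge0 : 0 <= tau.
Proof. by rewrite mulr_ge0// pi_ge0. Qed.

(** Unnormalized, and at a real frequency, since the Fejer kernel evaluates them at differences
    [j - l] of either sign. *)
Definition cos_coef f w : R := segint 0 (2 * pi) (fun s => f s * cos (w * s)).
Definition sin_coef f w : R := segint 0 (2 * pi) (fun s => f s * sin (w * s)).
Definition mode_energy f w : R := cos_coef f w ^+ 2 + sin_coef f w ^+ 2.

Lemma cos_nat2pi n : cos (n%:R * (2 * pi) : R) = 1.
Proof.
rewrite -[n%:R * _]add0r (_ : n%:R * (2 * pi) = (pi *+ 2) *+ n); last first.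
  by rewrite mulr_natl mulr_natl.
by rewrite (periodicn (@cosD2pi R)) cos0.
Qed.

Lemma sin_nat2pi n : sin (n%:R * (2 * pi) : R) = 0.
Proof.
rewrite -[n%:R * _]add0r (_ : n%:R * (2 * pi) = (pi *+ 2) *+ n); last first.
  by rewrite mulr_natl mulr_natl.
by rewrite (periodicn (@sinD2pi R)) sin0.
Qed.

Lemma cos_coef_1 (j l : nat) :
  cos_coef (fun=> 1) (j%:R - l%:R) = if j == l then 2 * pi else 0.
Proof.
rewrite /cos_coef; case: eqVneq => [->|jl].
  rewrite subrr (@eq_segint _ _ _ _ (fun=> 1)) ?segint_cst ?subr0 ?mul1r//.
  by move=> x _; rewrite mul0r cos0 mulr1.
have w0 : j%:R - l%:R != 0 :> R by rewrite subr_eq0 eqr_nat.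
set w : R := j%:R - l%:R in w0 *.
transitivity (w^-1 * sin (w * (2 * pi)) - w^-1 * sin (w * 0)).
  apply: (@segint_FTC _ _ _ (fun s => w^-1 * sin (w * s))) => //; first by cont.
  by move=> x; apply: has_deriv_eq; [der|rewrite /=; field].
by rewrite mulr0 sin0 mulrBl sinB !sin_nat2pi; ring.
Qed.

Lemma sin_coef_1 (j l : nat) : sin_coef (fun=> 1) (j%:R - l%:R) = 0.
Proof.
rewrite /sin_coef; have [->|jl] := eqVneq j l.
  rewrite subrr (@eq_segint _ _ _ _ (fun=> 0)) ?segint_cst ?mul0r//.
  by move=> x _; rewrite mul0r sin0 mulr0.
have w0 : j%:R - l%:R != 0 :> R by rewrite subr_eq0 eqr_nat.
set w : R := j%:R - l%:R in w0 *.
transitivity (- w^-1 * cos (w * (2 * pi)) - - w^-1 * cos (w * 0)).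
  apply: (@segint_FTC _ _ _ (fun s => - w^-1 * cos (w * s))) => //.
    by cont.
  by move=> x; apply: has_deriv_eq; [der|rewrite /=; field].
by rewrite mulr0 cos0 mulrBl cosB !sin_nat2pi !cos_nat2pi; ring.
Qed.

Lemma mode_energyN f w : continuous f -> mode_energy f (- w) = mode_energy f w.
Proof.
move=> cf; rewrite /mode_energy /cos_coef /sin_coef; congr (_ ^+ 2 + _).
  by apply: eq_segint => x _; rewrite mulNr cosN.
rewrite -[RHS]sqrrN -segintN; last by cont.
by congr (_ ^+ 2); apply: eq_segint => x _; rewrite mulNr sinN mulrN.
Qed.

Lemma mode_energy_ge0 f w : 0 <= mode_energy f w.
Proof. by rewrite addr_ge0 ?sqr_ge0. Qed.

(* [N] times the Fejer kernel. *)
Definition fejer N t : R :=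
  (\sum_(j < N) cos (j%:R * t)) ^+ 2 + (\sum_(j < N) sin (j%:R * t)) ^+ 2.

Lemma fejer_ge0 N t : 0 <= fejer N t.
Proof. by rewrite addr_ge0 ?sqr_ge0. Qed.

Lemma fejerE N t :
  fejer N t = \sum_(j < N) \sum_(l < N) cos ((j%:R - l%:R) * t).
Proof.
rewrite /fejer !expr2 !big_distrlr/= -big_split/=; apply: eq_bigr => j _.
by rewrite -big_split/=; apply: eq_bigr => l _; rewrite mulrBl cosB.
Qed.

(** Multiplication by [2 * sin (t / 2)] telescopes the geometric sum of the [exp (i j t)] to
    something of modulus at most 2. After division by [N] this is the concentration of the kernel
    near the multiples of [2 * pi]. *)
Lemma fejer_sin_le1 N t : fejer N t * sin (t / 2) ^+ 2 <= 1.
Proof.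
set h := t / 2.
have hC M : 2 * sin h * (\sum_(j < M) cos (j%:R * t)) =
    sin (M%:R * t - h) + sin h.
  elim: M => [|M IHM].
    by rewrite big_ord0 mul0r mulr0 sub0r sinN addrC subrr.
  rewrite big_ord_recr/= mulrDr IHM (_ : M.+1%:R * t - h = M%:R * t + h).
    by rewrite sinB sinD; ring.
  by rewrite /h -natr1; field.
have hS M : 2 * sin h * (\sum_(j < M) sin (j%:R * t)) =
    cos h - cos (M%:R * t - h).
  elim: M => [|M IHM].
    by rewrite big_ord0 mul0r mulr0 sub0r cosN subrr.
  rewrite big_ord_recr/= mulrDr IHM (_ : M.+1%:R * t - h = M%:R * t + h).
    by rewrite cosB cosD; ring.
  by rewrite /h -natr1; field.
have eF : 4 * (fejer N t * sin h ^+ 2) =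
    (2 * sin h * (\sum_(j < N) cos (j%:R * t))) ^+ 2
  + (2 * sin h * (\sum_(j < N) sin (j%:R * t))) ^+ 2 by rewrite /fejer; ring.
rewrite hC hS in eF.
set a := N%:R * t - h in eF.
have := cos2Dsin2 a; have := cos2Dsin2 h.
(* The two squares in [eF] add up to [2 - 2 * cos (a + h)]. *)
have := cos_geN1 (a + h); rewrite cosD; nra.
Qed.

Lemma cont_fejer N f : continuous f -> continuous (fun t => fejer N (f t)).
Proof.
by move=> cf; apply: contD; apply: contX;
  apply: (@cont_sum _ _ (fun j t => _ (j%:R * f t))) => j; cont.
Qed.

Lemma segint_fejer N f t : continuous f ->
  segint 0 (2 * pi) (fun s => f s * fejer N (s - t)) =
  \sum_(j < N) \sum_(l < N) (cos ((j%:R - l%:R) * t) * cos_coef f (j%:R - l%:R)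
     + sin ((j%:R - l%:R) * t) * sin_coef f (j%:R - l%:R)).
Proof.
move=> cf.
pose F j l s := cos ((j%:R - l%:R) * t) * (f s * cos ((j%:R - l%:R) * s))
     + sin ((j%:R - l%:R) * t) * (f s * sin ((j%:R - l%:R) * s)).
have cF j l : continuous (F j l) by rewrite /F; cont.
rewrite (@eq_segint _ _ _ _ (fun s => \sum_(j < N) \sum_(l < N) F j l s)).
  rewrite (@segint_sum _ _ _ _ (fun j s => \sum_(l < N) F j l s)); last first.
    by move=> j; apply: cont_sum.
  apply: eq_bigr => j _; rewrite (@segint_sum _ _ _ _ (fun l s => F j l s))//.
  apply: eq_bigr => l _; rewrite /F segintD; [|cont|cont].
  by rewrite !segintZ; [|cont|cont].
move=> s _; rewrite fejerE mulr_sumr; apply: eq_bigr => j _.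
rewrite mulr_sumr; apply: eq_bigr => l _.
by rewrite /F mulrBr cosB; ring.
Qed.

Lemma segint_fejer_1 N t :
  segint 0 (2 * pi) (fun s => fejer N (s - t)) = N%:R * (2 * pi).
Proof.
rewrite (@eq_segint _ _ _ _ (fun s => 1 * fejer N (s - t))); last first.
  by move=> s _; rewrite mul1r.
rewrite segint_fejer; last by cont.
rewrite (eq_bigr (fun=> 2 * pi)); first by rewrite sumr_const card_ord -[LHS]mulr_natl.
move=> j _; rewrite (bigD1 j)//= cos_coef_1 sin_coef_1 eqxx subrr mul0r cos0.
rewrite mulr0 addr0 mul1r big1 ?addr0// => l lj.
rewrite cos_coef_1 sin_coef_1 ifN ?mulr0 ?addr0//.
by apply: contraNN lj => /eqP jl; apply/eqP/val_inj.
Qed.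

(** In row [j] the frequencies [j - l] run from [j] down to [j - N + 1]. The energy being even in
    the frequency, each of the two halves of the row is at most a partial sum of the hypothesis. *)
Lemma sum_mode_energy N f (S : R) : continuous f ->
  (forall n, \sum_(m < n) mode_energy f m%:R <= S) ->
  \sum_(j < N) \sum_(l < N) mode_energy f (j%:R - l%:R) <= N%:R * (2 * S).
Proof.
move=> cf fS; pose e m := mode_energy f m%:R.
have eS m : \sum_(0 <= i < m) e i <= S by rewrite big_mkord; exact: fS.
have e0 m : 0 <= e m by exact: mode_energy_ge0.
rewrite mulr_natl -[leRHS](_ : \sum_(j < N) (2 * S) = _); last first.
  by rewrite sumr_const card_ord.
apply: ler_sum => j _.
rewrite -(big_mkord xpredT (fun l => mode_energy f (j%:R - l%:R))).
rewrite (@big_cat_nat _ _ _ (val j))//=; last by rewrite ltnW.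
rewrite [2 * S]mulr_natl mulr2n; apply: lerD.
  (* The terms [l < j] carry the frequencies 1 to [j]; adding frequency 0 completes a partial
     sum. *)
  rewrite big_nat_rev/= add0n (le_trans _ (eS j.+1))// big_nat_recl//=.
  rewrite ler_wpDl//; apply: ler_sum_nat => i /andP[_ ij].
  by rewrite /e -natrB ?subSS ?leq_subr// subKn.
rewrite -{1}(add0n (val j)) big_addn (le_trans _ (eS (N - j)%N))//.
apply: ler_sum_nat => i _.
by rewrite natrD opprD addrA addrAC subrr add0r mode_energyN.
Qed.

End Fourier.

(** * Uniform estimates on compact segments *)

Section Tube.
Variable R : realType.
Implicit Types (D : set R) (phi : R -> R -> R).

(** Convertible with [C0_on], so that the continuity clauses of [classical] apply directly. *)
Definition joint_continuous D phi : Prop :=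
  {within D `*` [set: R], continuous (fun p : R * R => phi p.1 p.2)}.

Lemma joint_continuousP D phi x z (e : R) : joint_continuous D phi -> D x ->
  0 < e -> exists2 d, 0 < d & forall x' z', D x' -> `|x - x'| < d ->
    `|z - z'| < d -> `|phi x z - phi x' z'| < e.
Proof.
move=> /subspace_continuousP cphi Dx e0.
have /cvgrPdist_lt /(_ _ e0) := cphi (x, z) (conj Dx I).
rewrite near_withinE => -[[U V] /= [[d1 /= d10 Ud1] [d2 /= d20 Vd2]] UV].
exists (Num.min d1 d2); first by rewrite lt_min d10 d20.
move=> x' z' Dx'; rewrite !lt_min => /andP[xd1 _] /andP[_ zd2].
by apply: (UV (x', z')) => //; split; [exact: Ud1|exact: Vd2].
Qed.

(** Tube lemma: local radii of continuity around the points of [[a, b]] are made common by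
    compactness. *)
Lemma joint_continuous_uniform D phi x a b (e : R) : joint_continuous D phi ->
  D x -> 0 < e -> exists2 d, 0 < d & forall x', D x' -> `|x' - x| < d ->
    forall z, a <= z <= b -> `|phi x' z - phi x z| < e.
Proof.
move=> cphi Dx e0.
have /compact_near_coveringP := @segment_compact R a b.
pose P x' z := D x' -> `|phi x' z - phi x z| < e.
move=> /(_ R (nbhs x) P _).
have e20 : 0 < e / 2 by rewrite divr_gt0.
case.
  move=> z _; have [d d0 Hd] := joint_continuousP z cphi Dx e20.
  exists (ball z d, ball x d) => /=.
    by split; [exists d|exists d].
  move=> [z' x'] /= [zz' xx'] Dx'.
  have H1 := Hd x' z' Dx' xx' zz'.
  have H2 : `|phi x z - phi x z'| < e / 2.
    by apply: Hd => //; rewrite subrr normr0.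
  rewrite (_ : _ - _ = (phi x z - phi x z') - (phi x z - phi x' z')); last by ring.
  rewrite (le_lt_trans (ler_normB _ _))// [e]splitr; lra.
move=> d /= d0 Hd; exists d => // x' Dx' xx' z zab.
by apply: (Hd x') => //=; rewrite ?in_itv// distrC.
Qed.

Lemma joint_continuous_at D phi x : joint_continuous D phi -> D x ->
  continuous (phi x).
Proof.
move=> cphi Dx z; apply/cvgrPdist_lt => e e0.
have [d d0 Hd] := joint_continuousP z cphi Dx e0.
by exists d => //= z' zz'; apply: Hd => //; rewrite subrr normr0.
Qed.

(** Turns [joint_continuous_uniform] into uniform continuity of [f], with the increment [h] as first
    variable. *)
Lemma joint_continuous_shift f : continuous f ->
  joint_continuous setT (fun h z => f (z + h) : R).
Proof.
move=> cf; apply: continuous_subspaceT => -[x z] /=.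
apply: (@continuous_comp _ _ _ (fun p : R * R => p.2 + p.1) f); last exact: cf.
by apply: cvgD; [exact: cvg_snd|exact: cvg_fst].
Qed.

Lemma continuous_bounded a b (f : R -> R) : continuous f ->
  exists2 M, 0 <= M & forall x, a <= x <= b -> `|f x| <= M.
Proof.
move=> cf; have [ab|ba] := leP a b; last first.
  by exists 0 => // x /andP[ax /(le_trans ax)]; rewrite leNgt ba.
have cn : {within `[a, b], continuous (fun x => `|f x|)}.
  by apply: continuous_subspaceT; exact: cont_norm.
have [c _ Hc] := EVT_max ab cn.
by exists `|f c| => // x xab; apply: Hc; rewrite in_itv.
Qed.

End Tube.

(** * A Parseval inequality by Fejer averaging *)

Section FejerInequality.
Variable R : realType.
Implicit Types (f : R -> R) (e : R).

(** The sine is the cosine of the distance to [pi / 2], and [x / 2] is at least as close to [pi / 2]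
    as [d / 2]. *)
Lemma sin_half_ge (d x : R) : 0 < d -> d <= x <= 2 * pi - d ->
  sin (d / 2) <= sin (x / 2).
Proof.
move=> d0 /andP[dx xd].
have p0 := @pi_gt0 R.
rewrite -!cosBpihalf -[cos (d / 2 - _)]cosN -[cos (x / 2 - _)]cos_norm.
have e1 : `|x / 2 - pi / 2| <= - (d / 2 - pi / 2) by rewrite ler_norml; lra.
have n0 := normr_ge0 (x / 2 - pi / 2).
rewrite leNgt ltr_cos ?in_itv/= -?leNgt//; apply/andP; split => //; lra.
Qed.

(** If [s] and [t] are close modulo the period, uniform continuity gives [e]. Otherwise the sine is
    bounded below and absorbs the sup bound of [f]. The factor [sin ((s - t) / 2) ^+ 2] is the one
    that [fejer_sin_le1] controls. *)
Lemma periodic_modulus f e : continuous f -> periodic f (2 * pi) -> 0 < e ->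
  exists2 C, 0 <= C & forall s t, 0 <= s <= 2 * pi -> 0 <= t <= 2 * pi ->
    (f s - f t) ^+ 2 <= e + C * sin ((s - t) / 2) ^+ 2.
Proof.
move=> cf pf e0; have p0 := @pi_gt0 R.
have [M M0 HM] := continuous_bounded 0 (2 * pi) cf.
(* The cap at 1 gives [e' ^+ 2 <= e' <= e]. *)
pose e' := Num.min 1 e.
have e'0 : 0 < e' by rewrite lt_min ltr01.
have e'e : e' ^+ 2 <= e.
  have e'1 : e' <= 1 by rewrite ge_min lexx.
  have : e' <= e by rewrite ge_min lexx orbT.
  by nra.
have [d1 d10 Hd1] := joint_continuous_uniform 0 (2 * pi)
  (joint_continuous_shift cf) (I : setT 0) e'0.
pose d := Num.min d1 1.
have d0 : 0 < d by rewrite lt_min d10 ltr01.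
have d1' : d <= 1 by rewrite ge_min lexx orbT.
have pi2 := @pi_ge2 R.
have Hd h z : 0 <= z <= 2 * pi -> `|h| < d -> (f (z + h) - f z) ^+ 2 <= e.
  move=> zI; rewrite lt_min => /andP[hd _].
  have := Hd1 h I; rewrite subr0 => /(_ hd z zI); rewrite addr0 => fe.
  apply: le_trans e'e; rewrite -real_normK ?num_real//.
  by rewrite ler_sqr ?nnegrE// ?ltW.
pose sd := sin (d / 2).
have sd0 : 0 < sd by apply: sin_gt0_pi; lra.
have C0 : 0 <= 4 * M ^+ 2 / sd ^+ 2.
  by rewrite divr_ge0 ?sqr_ge0// mulr_ge0// sqr_ge0.
exists (4 * M ^+ 2 / sd ^+ 2) => //.
have main s t : 0 <= s <= 2 * pi -> 0 <= t <= 2 * pi -> t <= s ->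
    (f s - f t) ^+ 2 <= e + 4 * M ^+ 2 / sd ^+ 2 * sin ((s - t) / 2) ^+ 2.
  move=> sI tI ts.
  have Cs0 : 0 <= 4 * M ^+ 2 / sd ^+ 2 * sin ((s - t) / 2) ^+ 2.
    by rewrite mulr_ge0// sqr_ge0.
  have [std|std] := ltP (s - t) d.
    rewrite ler_wpDr// -[s](subrKC t) Hd// ger0_norm ?subr_ge0//.
  (* Points near opposite ends of the period: shifting [s] by [2 * pi] brings it close to [t]. *)
  have [std2|std2] := ltP (2 * pi - d) (s - t).
    rewrite ler_wpDr// -(subrK (2 * pi) s) pf.
    rewrite (_ : s - 2 * pi = t + (s - t - 2 * pi)); last by ring.
    by rewrite Hd// ltr_norml; lra.
  apply: ler_wpDl; first exact: ltW.
  have sds : sd <= sin ((s - t) / 2) by apply: sin_half_ge => //; rewrite std.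
  rewrite -mulrA [_^-1 * _]mulrC.
  have : 1 <= sin ((s - t) / 2) ^+ 2 / sd ^+ 2.
    by rewrite ler_pdivlMr ?exprn_gt0// mul1r; nra.
  have fs := HM s sI; have ft := HM t tI.
  have : (f s - f t) ^+ 2 <= 4 * M ^+ 2.
    rewrite -real_normK ?num_real// (_ : 4 * M ^+ 2 = (M + M) ^+ 2); last by ring.
    rewrite ler_sqr ?nnegrE ?addr_ge0//.
    by rewrite (le_trans (ler_normB _ _))// lerD.
  move=> le1 le2; apply: (le_trans le1); rewrite ler_peMr//.
  by rewrite mulr_ge0// sqr_ge0.
move=> s t sI tI; have [ts|/ltW st] := leP t s; first exact: main.
rewrite -sqrrN opprB (_ : sin _ ^+ 2 = sin ((t - s) / 2) ^+ 2); first exact: main.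
by rewrite -[LHS]sqrrN -sinN; congr (sin _ ^+ 2); ring.
Qed.

(** Integrate [(f s - f t) ^+ 2 * fejer N (s - t)] over both variables. Expanding the square gives
    [4 * pi * N * J] minus twice the double sum of energies, which is at most [2 * N * S]. By
    [periodic_modulus] the integral is at most [N * e * (2 * pi) ^+ 2] plus a term independent of
    [N]. Divide by [N] and let it grow. *)
Lemma segint_sqr_le_modes f (S : R) : continuous f -> periodic f (2 * pi) ->
  (forall n, \sum_(m < n) mode_energy f m%:R <= S) ->
  pi * segint 0 (2 * pi) (fun s => f s ^+ 2) <= S.
Proof.
move=> cf pf fS; have p0 := @pi_gt0 R.
have pi0 : 0 <= 2 * pi :> R by rewrite mulr_ge0// ltW.
set J := segint _ _ _.
have cf2 : continuous (fun s => f s ^+ 2) by cont.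
apply/ler_addgt0Pr => d d0.
(* Chosen so that [e * (2 * pi) ^+ 2 = 2 * d]. *)
pose e := d / (2 * pi ^+ 2).
have e0 : 0 < e by rewrite divr_gt0// mulr_gt0// exprn_gt0.
have [C C0 HC] := periodic_modulus cf pf e0.
have key N : (0 < N)%N ->
    2 * (N%:R * (2 * pi)) * J - 2 * (N%:R * (2 * S)) <=
      (e * (N%:R * (2 * pi)) + C * (2 * pi)) * (2 * pi).
  move=> N0.
  (* By [segint_fejer], [G g] is the convolution of [g] with the kernel when [g] is continuous;
     [F g h] collects the terms of [h * G g]. *)
  pose G (g : R -> R) (t : R) : R := \sum_(j < N) \sum_(l < N)
     (cos ((j%:R - l%:R) * t) * cos_coef g (j%:R - l%:R)
     + sin ((j%:R - l%:R) * t) * sin_coef g (j%:R - l%:R)).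
  pose F (g h : R -> R) (j l : nat) (t : R) : R := (cos_coef g (j%:R - l%:R)) * (h t * cos ((j%:R - l%:R) * t))
     + sin_coef g (j%:R - l%:R) * (h t * sin ((j%:R - l%:R) * t)).
  have cF (g h : R -> R) j l : continuous h -> continuous (F g h j l).
    by move=> ch; rewrite /F; cont.
  have GE g h t : h t * G g t = \sum_(j < N) \sum_(l < N) F g h j l t.
    rewrite /G mulr_sumr; apply: eq_bigr => j _.
    rewrite mulr_sumr; apply: eq_bigr => l _; rewrite /F; ring.
  have cG (g h : R -> R) : continuous h -> continuous (fun t => h t * G g t).
    move=> ch; rewrite (_ : (fun t => _) =
      fun t => \sum_(j < N) \sum_(l < N) F g h j l t); last exact/funext/GE.
    apply: (@cont_sum _ _ (fun j t => \sum_(l < N) F g h j l t)) => j.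
    by apply: (@cont_sum _ _ (fun l t => F g h j l t)) => l; exact: cF.
  have intG (g h : R -> R) : continuous h -> segint 0 (2 * pi) (fun t => h t * G g t) =
      \sum_(j < N) \sum_(l < N) (cos_coef g (j%:R - l%:R) * cos_coef h (j%:R - l%:R)
       + sin_coef g (j%:R - l%:R) * sin_coef h (j%:R - l%:R)).
    move=> ch; rewrite (@eq_segint _ _ _ _
       (fun t => \sum_(j < N) \sum_(l < N) F g h j l t)); last by move=> *; exact: GE.
    rewrite (@segint_sum _ _ _ _ (fun j t => \sum_(l < N) F g h j l t)); last first.
      move=> j; apply: (@cont_sum _ _ (fun l t => F g h j l t)) => l; exact: cF.
    apply: eq_bigr => j _.
    rewrite (@segint_sum _ _ _ _ (fun l t => F g h j l t)); last first.
      by move=> l; exact: cF.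
    apply: eq_bigr => l _; rewrite /F segintD; [|cont|cont].
    by rewrite !segintZ; [|cont|cont].
  (* For fixed [t], the left side is the integral over [s] of [(f s - f t) ^+ 2 * fejer N (s - t)].
     The factor 1 gives all convolution terms the shape required by [intG]. *)
  have pt (t : R) : 0 <= t <= 2 * pi ->
      1 * G (fun s => f s ^+ 2) t + f t ^+ 2 * (N%:R * (2 * pi))
        - 2 * (f t * G f t) <= e * (N%:R * (2 * pi)) + C * (2 * pi).
    move=> tI.
    rewrite mul1r /G -!segint_fejer// -(segint_fejer_1 N t).
    have cK : continuous (fun s => fejer N (s - t)) by apply: cont_fejer; cont.
    rewrite -(subr0 (2 * pi)) -(segint_cst C pi0) subr0 -!segintZ; try by cont.
    rewrite -!segintD -?segintB; try by cont.
    apply: le_segint; [cont|cont|] => s sI.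
    have := HC s t sI tI; have := fejer_ge0 N (s - t).
    have := fejer_sin_le1 N (s - t).
    set K := fejer _ _; set sn := sin _ ^+ 2 => K1 K0 fe.
    have : K * (f s - f t) ^+ 2 <= K * (e + C * sn) by rewrite ler_wpM2l.
    have : C * (K * sn) <= C * 1 by rewrite ler_wpM2l.
    rewrite mulr1; nra.
  have := segint_cst (e * (N%:R * (2 * pi)) + C * (2 * pi)) pi0.
  rewrite subr0 => <-; apply: le_trans (le_segint _ _ pt); last 2 first.
  - apply: contD; first apply: contD; last apply: contN.
    + exact/cG/cont_cst.
    + by cont.
    + by apply: contM; [exact: cont_cst|exact: cG].
  - exact: cont_cst.
  rewrite segintB; last 2 first.
  - by apply: contD; [exact/cG/cont_cst|cont].
  - by apply: contM; [exact: cont_cst|exact: cG].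
  rewrite segintD; [|exact/cG/cont_cst|by cont].
  rewrite [X in _ <= _ - X]segintZ; last exact: cG.
  rewrite !intG//; last exact: cont_cst.
  have -> : segint 0 (2 * pi) (fun t => f t ^+ 2 * (N%:R * (2 * pi))) =
      N%:R * (2 * pi) * J.
    rewrite /J -segintZ//; apply: eq_segint => s _; exact: mulrC.
  rewrite [X in _ <= X + _ - _](_ : _ = N%:R * (2 * pi) * J); last first.
    rewrite (eq_bigr (fun=> (2 * pi) * J)); last first.
      move=> j _; rewrite (bigD1 j)//= [X in _ + X]big1 => [|l lj]; last first.
        rewrite cos_coef_1 sin_coef_1 ifN ?mulr0 ?addr0//.
        by apply: contraNN lj => /eqP jl; apply/eqP/val_inj.
      rewrite cos_coef_1 sin_coef_1 eqxx mulr0 !addr0 subrr mulrC; congr (_ * _).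
      by apply: eq_segint => s _; rewrite mul0r cos0 mulr1.
    by rewrite sumr_const card_ord -[LHS]mulr_natl mulrA.
  have := sum_mode_energy N cf fS; rewrite /mode_energy.
  under eq_bigr do under eq_bigr do rewrite !expr2.
  by set Q := \sum_(j < N) _ => QS; lra.
(* With this [N], [key] divided by [N] reads [4 * pi * J - 4 * S <= 2 * d + 2 * d]. *)
have [N HN] : exists N : nat, C * (2 * pi) ^+ 2 <= N%:R * (2 * d) /\ (0 < N)%N.
  exists (Num.truncn (C * (2 * pi) ^+ 2 / (2 * d))).+1; split => //.
  rewrite -ler_pdivrMr; last by lra.
  exact/ltW/truncnS_gt.
have N0 : 0 < N%:R :> R by rewrite ltr0n; case: HN.
have k := key N HN.2; move: HN => [HN _].
have eE : e * (2 * pi) ^+ 2 = 2 * d by rewrite /e; field; lra.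
rewrite [leRHS](_ : _ = N%:R * (e * (2 * pi) ^+ 2) + C * (2 * pi) ^+ 2) in k;
  last by ring.
rewrite eE in k.
rewrite -(ler_pM2l N0); lra.
Qed.

End FejerInequality.

(** * The Dirichlet-to-Neumann relation of a Fourier mode *)

Section ModeODE.
Variable R : realType.
Implicit Types (f : R -> R) (x : R).

Lemma has_deriv_MVT f (df : R -> R) (a b : R) : a < b ->
  (forall x, a <= x <= b -> has_deriv f x (df x)) ->
  exists2 x, a <= x <= b & f b - f a = df x * (b - a).
Proof.
move=> ab fd.
have [||x + ->] := @MVT R f df a b ab.
- by move=> x; rewrite in_itv/= => /andP[/ltW ax /ltW xb]; apply: fd; rewrite ax.
- apply: derivable_within_continuous => x; rewrite in_itv/= => xab.
  by have [] := fd x xab.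
by rewrite in_itv/= => /andP[/ltW ax /ltW xb]; exists x => //; rewrite ax.
Qed.

Definition vanishes_at_ninfty f : Prop :=
  forall e : R, 0 < e -> exists M, forall x, x < M -> `|f x| < e.

(* With Z = A - iB and nu = a + ib, the hypotheses say that
   Z'' + c Z' = nu (nu + c) Z. If Y = Z' - nu Z is not 0 then, as
   Y' = - (c + nu) Y, the quotient T = Z / Y satisfies T' = 1 + (c + 2 nu) T
   and |Y| is bounded below at -oo; so T -> 0 and T' -> 1, which is absurd. *)
Lemma decaying_mode_first_order (A A1 A2 B B1 B2 : R -> R) (a b c : R) :
  0 <= a -> 0 < c ->
  (forall x, x < 0 -> has_deriv A x (A1 x)) ->
  (forall x, x < 0 -> has_deriv A1 x (A2 x)) ->
  (forall x, x < 0 -> has_deriv B x (B1 x)) ->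
  (forall x, x < 0 -> has_deriv B1 x (B2 x)) ->
  (forall x, x < 0 -> A2 x =
     - c * A1 x + (a ^+ 2 - b ^+ 2 + c * a) * A x + (2 * a * b + c * b) * B x) ->
  (forall x, x < 0 -> B2 x =
     - c * B1 x + (a ^+ 2 - b ^+ 2 + c * a) * B x - (2 * a * b + c * b) * A x) ->
  vanishes_at_ninfty A -> vanishes_at_ninfty B ->
  forall x, x < 0 -> A1 x = a * A x + b * B x /\ B1 x = a * B x - b * A x.
Proof.
move=> a0 c0 dA dA1 dB dB1 eA eB vA vB x0 x00.
pose P x := A1 x - a * A x - b * B x.
pose Q x := B1 x - a * B x + b * A x.
pose q x := P x ^+ 2 + Q x ^+ 2.
have dP x : x < 0 -> has_deriv P x (- (c + a) * P x - b * Q x).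
  move=> xn; have h1 := dA x xn; have h2 := dA1 x xn; have h3 := dB x xn.
  by rewrite /P; apply: has_deriv_eq; [der|rewrite /= eA//= /P /Q; ring].
have dQ x : x < 0 -> has_deriv Q x (b * P x - (c + a) * Q x).
  move=> xn; have h1 := dA x xn; have h2 := dB1 x xn; have h3 := dB x xn.
  by rewrite /Q; apply: has_deriv_eq; [der|rewrite /= eB//= /P /Q; ring].
have dq x : x < 0 -> has_deriv q x (- 2 * (c + a) * q x).
  move=> xn; have h1 := dP x xn; have h2 := dQ x xn.
  by rewrite /q; apply: has_deriv_eq; [der|rewrite /=; ring].
have q0 x : 0 <= q x by rewrite addr_ge0 ?sqr_ge0.
suff : q x0 = 0.
  rewrite /q => /eqP; rewrite paddr_eq0 ?sqr_ge0// !sqrf_eq0 => /andP[/eqP Px /eqP Qx].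
  by move: Px Qx; rewrite /P /Q; lra.
apply/eqP; apply/negPn/negP => qx0.
have {}qx0 : 0 < q x0 by rewrite lt_neqAle eq_sym qx0 q0.
(* [q], the squared modulus of Y, is nonincreasing because [c + a >= 0]. *)
have qx x : x < x0 -> q x0 <= q x.
  move=> xx0.
  have dq' y : x <= y <= x0 -> has_deriv q y (- 2 * (c + a) * q y).
    by move=> /andP[_ yx0]; apply: dq; exact: le_lt_trans x00.
  have [y /andP[_ yx0]] := has_deriv_MVT xx0 dq'; have := q0 y; have : 0 < x0 - x by rewrite subr_gt0.
  set u := x0 - x; set v := q y => u0 v0 E.
  have : 0 <= (c + a) * v * u by rewrite !mulr_ge0//; lra.
  by lra.
(* Bounds |Y| / |Y|^2 without square roots: [|y| <= (1 + y ^+ 2) / 2 <= (1 + q x) / 2] and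
   [1 <= q x / q x0]. *)
pose kap := (1 + (q x0)^-1) / 2.
have kap0 : 0 < kap by rewrite divr_gt0// addr_gt0// invr_gt0.
have bnd x y : x < x0 -> y ^+ 2 <= q x -> `|y| / q x <= kap.
  move=> xx0 yq; have qx1 := qx x xx0.
  have qx2 : 0 < q x := lt_le_trans qx0 qx1.
  rewrite ler_pdivrMr// /kap mulrAC ler_pdivlMr// mulrDl mul1r.
  have : 1 <= (q x0)^-1 * q x by rewrite mulrC ler_pdivlMr// mul1r.
  have : 0 <= (`|y| - 1) ^+ 2 by rewrite sqr_ge0.
  by move: yq; rewrite -[y ^+ 2]real_normK ?num_real//; lra.
(* Y = P - i Q, and [Tr], [Ti] are the real and imaginary parts of Z / Y. *)
pose Tr x := (A x * P x + B x * Q x) / q x.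
pose Ti x := (A x * Q x - B x * P x) / q x.
have dTr x : x < x0 -> has_deriv Tr x (1 + (c + 2 * a) * Tr x - 2 * b * Ti x).
  move=> xx0; have xn : x < 0 := lt_trans xx0 x00.
  have qn : q x != 0 by rewrite gt_eqF// (lt_le_trans qx0)// qx.
  have h1 := dA x xn; have h2 := dB x xn; have h3 := dP x xn; have h4 := dQ x xn.
  have h5 := derV qn (dq x xn).
  have eA1 : A1 x = P x + a * A x + b * B x by rewrite /P; ring.
  have eB1 : B1 x = Q x + a * B x - b * A x by rewrite /Q; ring.
  rewrite /Tr /Ti; apply: has_deriv_eq; first by der.
  rewrite /= eA1 eB1; move: qn; rewrite /q => qn; field.
  exact: qn.
pose L := c + 2 * a + 2 * `|b|.
have L0 : 0 < L by rewrite /L; have := normr_ge0 b; lra.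
(* If |Tr| and |Ti| are at most [eta], then [Tr] varies by at most 1/4 over the unit interval from
   [M - 2] to [M - 1], while its derivative is at least [1 - L * eta >= 3/4]: a contradiction by the
   mean value theorem. *)
pose eta := Num.min (8^-1) (4 * L)^-1.
have eta0 : 0 < eta by rewrite lt_min !invr_gt0 mulr_gt0 ?ltr0n.
have eta8 : eta <= 8^-1 by rewrite ge_min lexx.
have etaL : eta * L <= 4^-1.
  have : eta <= (4 * L)^-1 by rewrite ge_min lexx orbT.
  by rewrite invfM -ler_pdivlMr.
pose e := eta / (2 * kap).
have e0 : 0 < e by rewrite divr_gt0// mulr_gt0.
have [MA HA] := vA e e0; have [MB HB] := vB e e0.
pose M := Num.min x0 (Num.min MA MB).
have small x y z : x < M -> y ^+ 2 <= q x -> z ^+ 2 <= q x ->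
    `|(A x * y + B x * z) / q x| <= eta.
  rewrite !lt_min => /and3P[xx0 xA xB] yq zq.
  have ya := bnd x y xx0 yq; have za := bnd x z xx0 zq.
  have Ax := HA x xA; have Bx := HB x xB.
  have qx2 : 0 < q x := lt_le_trans qx0 (qx x xx0).
  rewrite mulrDl (le_trans (ler_normD _ _))// -!mulrA !normrM.
  rewrite normfV (ger0_norm (q0 x)).
  have -> : eta = e * kap + e * kap by rewrite /e; field; rewrite gt_eqF.
  by rewrite lerD// ler_pM// ?mulr_ge0 ?invr_ge0// ltW.
have sTr x : x < M -> `|Tr x| <= eta.
  by move=> xM; apply: small => //; rewrite /q ?lerDl ?lerDr sqr_ge0.
have sTi x : x < M -> `|Ti x| <= eta.
  move=> xM; rewrite /Ti -mulrN; apply: small => //.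
    by rewrite /q lerDr sqr_ge0.
  by rewrite sqrrN /q lerDl sqr_ge0.
have M12 : M - 2 < M - 1 by lra.
have Mx0 : M <= x0 by rewrite ge_min lexx.
have dTr' y : M - 2 <= y <= M - 1 ->
    has_deriv Tr y (1 + (c + 2 * a) * Tr y - 2 * b * Ti y).
  by move=> /andP[_ yM]; apply: dTr; lra.
have [y /andP[_ y1] E] := has_deriv_MVT M12 dTr'.
have yM : y < M by lra.
have M1 : M - 1 < M by lra.
have M2 : M - 2 < M by lra.
have h1 := sTr _ M1; have h2 := sTr _ M2; have h3 := sTr _ yM; have h4 := sTi _ yM.
have h5 : `|(c + 2 * a) * Tr y| <= (c + 2 * a) * eta.
  rewrite normrM ger0_norm; last by lra.
  by rewrite ler_wpM2l//; lra.
have h6 : `|b * Ti y| <= `|b| * eta by rewrite normrM ler_wpM2l.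
rewrite /L in etaL.
move: h1 h2 h5 h6; rewrite !ler_norml => /andP[h1 h1'] /andP[h2 h2'] /andP[h5 h5'] /andP[h6 h6'].
move: E; rewrite -[2 * b * _]mulrA; lra.
Qed.

End ModeODE.

(** * The root of the dispersion relation and the size of the multiplier *)

Section Multiplier.
Variable R : realType.
Implicit Types (a b c k w : R).

(* Real and imaginary part of the root nu with nonnegative real part of
   nu ^ 2 + c nu = kap + i om; [s] is the real part of the square root of the
   discriminant. *)
Lemma mode_root c kap om : 0 < c -> 0 <= kap -> exists a b : R,
  [/\ 0 <= a, a ^+ 2 - b ^+ 2 + c * a = kap & 2 * a * b + c * b = om].
Proof.
move=> c0 kap0.
pose D := c ^+ 2 + 4 * kap.
pose S := Num.sqrt (D ^+ 2 + 16 * om ^+ 2).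
have c20 : 0 < c ^+ 2 by rewrite exprn_gt0.
have D0 : 0 < D by rewrite /D; lra.
have om20 : 0 <= om ^+ 2 by rewrite sqr_ge0.
have S2 : S ^+ 2 = D ^+ 2 + 16 * om ^+ 2.
  by rewrite sqr_sqrtr// addr_ge0 ?sqr_ge0// mulr_ge0.
have DS : D <= S.
  by rewrite -ler_sqr ?nnegrE ?sqrtr_ge0 ?(ltW D0)// S2; lra.
pose s := Num.sqrt ((D + S) / 2).
have s2 : s ^+ 2 = (D + S) / 2 by rewrite sqr_sqrtr//; lra.
(* [s ^+ 2] is the mean of [D] and [S], both at least [c ^+ 2]; this makes the real part
   [(s - c) / 2] nonnegative. *)
have cs : c <= s.
  by rewrite -ler_sqr ?nnegrE ?sqrtr_ge0 ?(ltW c0)// s2 -/D; move: DS; rewrite /D; lra.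
have s0 : 0 < s by exact: lt_le_trans cs.
exists ((s - c) / 2), (om / s); split.
- by lra.
- have -> : ((s - c) / 2) ^+ 2 - (om / s) ^+ 2 + c * ((s - c) / 2) =
      (s ^+ 2 - c ^+ 2) / 4 - om ^+ 2 / s ^+ 2 by field; rewrite gt_eqF.
  have DS0 : D + S != 0 by rewrite gt_eqF//; lra.
  rewrite s2.
  have -> : om ^+ 2 = (S ^+ 2 - D ^+ 2) / 16 by rewrite S2; field.
  have -> : (S ^+ 2 - D ^+ 2) / 16 / ((D + S) / 2) = (S - D) / 8 by field.
  by rewrite /D; field.
- by field; rewrite gt_eqF.
Qed.

(** The minimum is a lower bound of |nu|^2 / w^2. The summand [K2 ^+ 2] serves the regime [c <= w],
    the next one the regime [w < c]. The factor 4 comes from [w + c <= 2 * max(w, c)]. *)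
Definition multiplier_const (ky K1 K2 : R) : R :=
  4 * (1 + (K2 ^+ 2 + (ky ^+ 2 + K2 ^+ 2) ^+ 2 * (1 + 4 * K2 ^+ 2)) /
    Num.min (K1 ^+ 2 / 9) (ky ^+ 2 / 2)).

Lemma multiplier_const_gt0 ky K1 K2 : 0 < ky -> 0 < K1 ->
  0 < multiplier_const ky K1 K2.
Proof.
move=> ky0 K10; rewrite mulr_gt0// ltr_wpDr// divr_ge0//.
  by rewrite addr_ge0 ?sqr_ge0// mulr_ge0 ?sqr_ge0// addr_ge0// mulr_ge0// sqr_ge0.
by rewrite le_min !divr_ge0 ?sqr_ge0.
Qed.

(** With nu = a + i b, this is |nu - i k w| <= C w |nu| / (w + c), uniform in [c]. The imaginary
    equation gives [b = k * c * w / (2 * a + c)], hence [0 <= b <= k * w]. *)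
Lemma multiplier_bound ky K1 K2 a b c k w : 0 < ky -> 0 < K1 -> K1 <= k -> k <= K2 ->
  0 < c -> 0 < w -> 0 <= a ->
  a ^+ 2 - b ^+ 2 + c * a = ky ^+ 2 * w ^+ 2 -> 2 * a * b + c * b = k * c * w ->
  (a ^+ 2 + (b - k * w) ^+ 2) * (w + c) ^+ 2 <=
    multiplier_const ky K1 K2 * w ^+ 2 * (a ^+ 2 + b ^+ 2).
Proof.
move=> ky0 K10 K1k kK2 c0 w0 a0 e1 e2.
have k0 : 0 < k by lra.
pose B := Num.min (K1 ^+ 2 / 9) (ky ^+ 2 / 2).
have B0 : 0 < B by rewrite lt_min !divr_gt0 ?exprn_gt0.
have B1 : B <= k ^+ 2 / 9.
  have : B <= K1 ^+ 2 / 9 by rewrite ge_min lexx.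
  have : K1 ^+ 2 <= k ^+ 2 by rewrite ler_sqr ?nnegrE; lra.
  by lra.
have B2 : B <= ky ^+ 2 / 2 by rewrite ge_min lexx orbT.
have s0 : 0 < 2 * a + c by lra.
have bE : b = k * c * w / (2 * a + c).
  by apply: (mulIf (lt0r_neq0 s0)); rewrite divfK ?lt0r_neq0// -e2; ring.
have kw0 : 0 < k * w by rewrite mulr_gt0.
have b0 : 0 <= b by rewrite bE divr_ge0 ?ltW// mulr_gt0// mulr_gt0.
have bk : b <= k * w.
  rewrite bE ler_pdivrMr// (_ : k * c * w = k * w * c); last by ring.
  by rewrite ler_wpM2l ?(ltW kw0)//; lra.
have w20 : 0 < w ^+ 2 by rewrite exprn_gt0.
(* If [a <= c], then [b >= k * w / 3]. If [a > c], the real equation gives [2 * a ^+ 2 >= a ^+ 2 + c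
   * a >= ky ^+ 2 * w ^+ 2]. *)
have low : B * w ^+ 2 <= a ^+ 2 + b ^+ 2.
  have [ac|ca] := leP a c.
    have : k * w / 3 <= b.
      rewrite bE ler_pdivlMr// (_ : k * w / 3 * _ = k * w * (2 * a + c) / 3); last by ring.
      rewrite ler_pdivrMr// (_ : k * c * w * 3 = k * w * (3 * c)); last by ring.
      by rewrite ler_wpM2l ?(ltW kw0)//; lra.
    have : 0 <= k * w / 3 by rewrite divr_ge0// ltW.
    have : B * w ^+ 2 <= k ^+ 2 / 9 * w ^+ 2 by rewrite ler_wpM2r// ltW.
    have : 0 <= a ^+ 2 by rewrite sqr_ge0.
    rewrite (_ : k ^+ 2 / 9 * w ^+ 2 = (k * w / 3) ^+ 2); last by field.
    by nra.
  have : B * w ^+ 2 <= ky ^+ 2 / 2 * w ^+ 2 by rewrite ler_wpM2r// ltW.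
  have : 0 <= b ^+ 2 by rewrite sqr_ge0.
  by nra.
set N := a ^+ 2 + b ^+ 2 in low *.
have K220 : 0 <= K2 ^+ 2 by rewrite sqr_ge0.
have ky20 : 0 <= ky ^+ 2 by rewrite sqr_ge0.
have kK : k ^+ 2 <= K2 ^+ 2 by rewrite ler_sqr ?nnegrE; lra.
pose L := ky ^+ 2 + K2 ^+ 2.
pose G := L ^+ 2 * (1 + 4 * K2 ^+ 2).
have L20 : 0 <= L ^+ 2 by rewrite sqr_ge0.
have G0 : 0 <= G by rewrite mulr_ge0//; lra.
have N0 : 0 <= N by rewrite addr_ge0 ?sqr_ge0.
have CE : multiplier_const ky K1 K2 * w ^+ 2 * N =
    4 * w ^+ 2 * N + 4 * w ^+ 2 * ((K2 ^+ 2 + G) * (N / B)).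
  by rewrite /multiplier_const -/L -/G -/B; field; rewrite gt_eqF.
have NB : w ^+ 2 <= N / B by rewrite ler_pdivlMr// mulrC.
set M := N / B in NB CE.
have M0 : 0 <= M by rewrite (le_trans _ NB)// ltW.
(* For [c <= w] the crude bound |nu - i k w|^2 <= |nu|^2 + k^2 w^2 is enough. For [w < c] both parts
   of nu - i k w are controlled by [a], and [a * c <= L * w ^+ 2] makes [a] small. *)
rewrite CE; have [cw|wc] := leP c w.
  have h1 : a ^+ 2 + (b - k * w) ^+ 2 <= N + K2 ^+ 2 * M.
    have : (b - k * w) ^+ 2 <= k ^+ 2 * w ^+ 2.
      rewrite -exprMn -sqrrN ler_sqr ?nnegrE; lra.
    have : k ^+ 2 * w ^+ 2 <= K2 ^+ 2 * M by rewrite ler_pM// ?sqr_ge0.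
    have : 0 <= b ^+ 2 by rewrite sqr_ge0.
    by rewrite /N; lra.
  have h2 : (w + c) ^+ 2 <= 4 * w ^+ 2.
    by rewrite (_ : 4 * w ^+ 2 = (2 * w) ^+ 2); [rewrite ler_sqr ?nnegrE; lra|ring].
  have h3 : 0 <= a ^+ 2 + (b - k * w) ^+ 2 by rewrite addr_ge0 ?sqr_ge0.
  have h4 : 0 <= (w + c) ^+ 2 by rewrite sqr_ge0.
  apply: (le_trans (ler_pM h3 h4 h1 h2)).
  have := mulr_ge0 (ltW w20) (mulr_ge0 G0 M0).
  by lra.
have aL : a * c <= L * w ^+ 2.
  have : b ^+ 2 <= (k * w) ^+ 2 by rewrite ler_sqr ?nnegrE//; lra.
  have : k ^+ 2 * w ^+ 2 <= K2 ^+ 2 * w ^+ 2 by rewrite ler_wpM2r// ltW.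
  have : 0 <= a ^+ 2 by rewrite sqr_ge0.
  by rewrite exprMn /L; lra.
have kb : k * w - b <= 2 * a * k.
  have -> : k * w - b = 2 * a * k * (w / (2 * a + c)).
    by rewrite bE; field; rewrite gt_eqF.
  have : w / (2 * a + c) <= 1 by rewrite ler_pdivrMr// mul1r; lra.
  have : 0 <= 2 * a * k by rewrite !mulr_ge0// ltW.
  by move=> u0 v1; rewrite -[leRHS]mulr1 ler_wpM2l.
have h1 : (a ^+ 2 + (b - k * w) ^+ 2) <= a ^+ 2 * (1 + 4 * K2 ^+ 2).
  have : (b - k * w) ^+ 2 <= (2 * a * k) ^+ 2.
    by rewrite -sqrrN ler_sqr ?nnegrE; lra.
  have : a ^+ 2 * k ^+ 2 <= a ^+ 2 * K2 ^+ 2 by rewrite ler_wpM2l ?sqr_ge0.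
  by rewrite !exprMn; lra.
have h2 : (w + c) ^+ 2 <= 4 * c ^+ 2.
  by rewrite (_ : 4 * c ^+ 2 = (2 * c) ^+ 2); [rewrite ler_sqr ?nnegrE; lra|ring].
have h3 : 0 <= a ^+ 2 + (b - k * w) ^+ 2 by rewrite addr_ge0 ?sqr_ge0.
have h4 : 0 <= (w + c) ^+ 2 by rewrite sqr_ge0.
apply: (le_trans (ler_pM h3 h4 h1 h2)).
have h5 : (a * c) ^+ 2 <= (L * w ^+ 2) ^+ 2.
  have ac0 : 0 <= a * c by rewrite mulr_ge0// ltW.
  by rewrite ler_sqr ?nnegrE// (le_trans ac0).
have h6 : (a * c) ^+ 2 * (1 + 4 * K2 ^+ 2) <= G * w ^+ 2 * w ^+ 2.
  rewrite (_ : G * _ * _ = (L * w ^+ 2) ^+ 2 * (1 + 4 * K2 ^+ 2)); last by rewrite /G; ring.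
  by rewrite ler_wpM2r//; lra.
have h7 : G * w ^+ 2 * w ^+ 2 <= G * w ^+ 2 * M.
  by rewrite ler_wpM2l//; exact: mulr_ge0 G0 (ltW w20).
have h8 := mulr_ge0 (ltW w20) N0.
have h9 := mulr_ge0 (ltW w20) (mulr_ge0 K220 M0).
rewrite exprMn in h6; lra.
Qed.

End Multiplier.

(** * Integrals depending on a parameter *)

Section UnderIntegral.
Variable R : realType.
Implicit Types (D : set R) (f fx : R -> R -> R) (h : R -> R).

Lemma has_derivP (F : R -> R) (x l : R) :
  (forall e, 0 < e -> exists2 d, 0 < d & forall y, y != x -> `|y - x| < d ->
     `|F y - F x - l * (y - x)| <= e * `|y - x|) -> has_deriv F x l.
Proof.
move=> H.
have cF : (fun t => t^-1 *: (F (t *: 1 + x) - F x)) @ 0^' --> l.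
  apply/cvgrPdist_le => e e0; have [d d0 Hd] := H e e0.
  exists d => //= t /=; rewrite sub0r normrN => td t0.
  have -> : t *: 1 + x = x + t by rewrite [t *: 1]mulr1 addrC.
  have := Hd (x + t); rewrite addrAC subrr add0r => /(_ _ td) {}Hd.
  have {}Hd : `|F (x + t) - F x - l * t| <= e * `|t|.
    by apply: Hd; rewrite -subr_eq0 addrAC subrr add0r.
  rewrite distrC -(ler_pM2r (_ : 0 < `|t|)) ?normr_gt0// -normrM.
  apply: le_trans Hd; rewrite le_eqVlt; apply/orP; left; apply/eqP; congr `|_|.
  by rewrite /GRing.scale/=; field.
split; first by apply/cvg_ex; exists l.
by rewrite /derive; apply: cvg_lim.
Qed.

(** For each [z] the increment is a value of [fx] at an intermediate abscissa, and [fx] is uniformly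
    close to its value at [x] along the segment. *)
Lemma has_deriv_segint f fx h a b x : a <= b -> continuous h ->
  joint_continuous [set x | x < 0] fx ->
  (forall x, x < 0 -> continuous (f x)) ->
  (forall x z, x < 0 -> has_deriv (f^~ z) x (fx x z)) -> x < 0 ->
  has_deriv (fun x => segint a b (fun z => f x z * h z)) x
    (segint a b (fun z => fx x z * h z)).
Proof.
move=> ab ch cfx cf df x0; apply: has_derivP => e e0.
have [H H0 Hh] := continuous_bounded a b ch.
pose e' := e / ((1 + H) * (1 + (b - a))).
have k0 : 0 < (1 + H) * (1 + (b - a)) by rewrite mulr_gt0//; lra.
have e'0 : 0 < e' by rewrite divr_gt0.
have [d d0 Hd] := joint_continuous_uniform a b cfx x0 e'0.
(* The bound [- x] keeps [y] in the open half-line. *)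
exists (Num.min d (- x)); first by rewrite lt_min d0; lra.
move=> y yx; rewrite lt_min => /andP[yd yx0].
have y0 : y < 0 by move: yx0; rewrite ltr_norml; lra.
have cfy := cf y y0; have cfx0 := cf x x0.
have cfxx := joint_continuous_at cfx x0.
rewrite mulrC -segintZ; last by cont.
rewrite -!segintB; try by cont.
have bnd z : a <= z <= b ->
    `|f y z * h z - f x z * h z - (y - x) * (fx x z * h z)| <=
      e' * `|y - x| * H.
  move=> zab; rewrite (_ : _ - _ = (f y z - f x z - fx x z * (y - x)) * h z);
    last by ring.
  rewrite normrM ler_pM ?Hh//.
  have [c [cy0 cyx] ->] : exists2 c, (c < 0 /\ `|c - x| < d) &
      f y z - f x z = fx c z * (y - x).
    have [yltx|xlty|yE] := ltgtP y x; last by rewrite yE eqxx in yx.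
    - have [t /= t1|c /andP[c1 c2] E] :=
          @has_deriv_MVT _ (f^~ z) (fx^~ z) _ _ yltx.
        by apply: df; lra.
      exists c; last by move: E => /=; lra.
      split; first by lra.
      by apply: le_lt_trans yd; rewrite ler0_norm ?ler0_norm; lra.
    - have [t /= t1|c /andP[c1 c2] E] :=
          @has_deriv_MVT _ (f^~ z) (fx^~ z) _ _ xlty.
        by apply: df; lra.
      exists c; last by move: E => /=; lra.
      split; first by lra.
      by apply: le_lt_trans yd; rewrite ger0_norm ?ger0_norm; lra.
  by rewrite -mulrBl normrM ler_wpM2r// ltW// Hd.
apply: (le_trans (ler_norm_segint_cst ab _ bnd)); first by cont.
rewrite (_ : _ * (b - a) = e' * (H * (b - a)) * `|y - x|); last by ring.
rewrite ler_wpM2r// /e' mulrAC ler_pdivrMr// ler_wpM2l ?(ltW e0)//.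
by rewrite ler_pM//; lra.
Qed.

(** Stated for any [D], so that it applies at the boundary point 0 of the closed half-line. *)
Lemma segint_parameter_continuous D f h a b x e : a <= b -> continuous h ->
  joint_continuous D f -> D x -> 0 < e ->
  exists2 d, 0 < d & forall x', D x' -> `|x' - x| < d ->
   `|segint a b (fun z => f x' z * h z) - segint a b (fun z => f x z * h z)| <= e.
Proof.
move=> ab ch cf Dx e0.
have [H H0 Hh] := continuous_bounded a b ch.
pose e' := e / ((1 + H) * (1 + (b - a))).
have k0 : 0 < (1 + H) * (1 + (b - a)) by rewrite mulr_gt0//; lra.
have e'0 : 0 < e' by rewrite divr_gt0.
have [d d0 Hd] := joint_continuous_uniform a b cf Dx e'0.
exists d => // x' Dx' xx'.
have cfx := joint_continuous_at cf Dx; have cfx' := joint_continuous_at cf Dx'.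
rewrite -segintB; try by cont.
have bnd z : a <= z <= b -> `|f x' z * h z - f x z * h z| <= e' * H.
  by move=> zab; rewrite -mulrBl normrM ler_pM ?Hh// ltW// Hd.
apply: (le_trans (ler_norm_segint_cst ab _ bnd)); first by cont.
rewrite -mulrA /e' mulrAC ler_pdivrMr// ler_wpM2l ?(ltW e0)//.
by rewrite ler_pM//; lra.
Qed.

End UnderIntegral.

Section FourierDerivative.
Variable R : realType.
Implicit Types (f g df : R -> R) (n : nat).

Lemma cos_coef_deriv f df n : continuous df ->
  (forall z, has_deriv f z (df z)) -> periodic f (2 * pi) ->
  cos_coef df n%:R = n%:R * sin_coef f n%:R.
Proof.
move=> cdf fd pf; have cf := der_continuous fd.
have p0 : 0 <= 2 * pi :> R by rewrite mulr_ge0// pi_ge0.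
pose dg z : R := - sin (n%:R * z) * n%:R.
have gd z : has_deriv (fun z => cos (n%:R * z)) z (dg z).
  by apply: has_deriv_eq; [der|rewrite /dg /=; ring].
have cdg : continuous dg by rewrite /dg; cont.
have := segint_by_parts p0 cdf cdg fd gd.
have pf0 : f (2 * pi) = f 0 by rewrite -[RHS]pf add0r.
rewrite mulr0 cos0 cos_nat2pi pf0 subrr sub0r.
rewrite /cos_coef /sin_coef -segintZ; last by cont.
move=> /(congr1 -%R); rewrite opprK => <-; rewrite -segintN; last by cont.
by apply: eq_segint => z _; rewrite /dg; ring.
Qed.

Lemma sin_coef_deriv f df n : continuous df ->
  (forall z, has_deriv f z (df z)) -> periodic f (2 * pi) ->
  sin_coef df n%:R = - (n%:R * cos_coef f n%:R).
Proof.
move=> cdf fd pf; have cf := der_continuous fd.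
have p0 : 0 <= 2 * pi :> R by rewrite mulr_ge0// pi_ge0.
pose dg z : R := cos (n%:R * z) * n%:R.
have gd z : has_deriv (fun z => sin (n%:R * z)) z (dg z).
  by apply: has_deriv_eq; [der|rewrite /dg /=; ring].
have cdg : continuous dg by rewrite /dg; cont.
have := segint_by_parts p0 cdf cdg fd gd.
rewrite mulr0 sin0 sin_nat2pi !mulr0 subrr sub0r.
rewrite /cos_coef /sin_coef -segintZ; last by cont.
move=> /(congr1 -%R); rewrite opprK => <-; congr (- _).
by apply: eq_segint => z _; rewrite /dg; ring.
Qed.

Lemma cos_coef_lin f g a b w : continuous f -> continuous g ->
  cos_coef (fun z => a * f z + b * g z) w = a * cos_coef f w + b * cos_coef g w.
Proof.
move=> cf cg; rewrite /cos_coef -!segintZ; try by cont.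
rewrite -segintD; try by cont.
by apply: eq_segint => z _; ring.
Qed.

Lemma sin_coef_lin f g a b w : continuous f -> continuous g ->
  sin_coef (fun z => a * f z + b * g z) w = a * sin_coef f w + b * sin_coef g w.
Proof.
move=> cf cg; rewrite /sin_coef -!segintZ; try by cont.
rewrite -segintD; try by cont.
by apply: eq_segint => z _; ring.
Qed.

Lemma periodic_deriv f df (T : R) : (forall z, has_deriv f z (df z)) ->
  periodic f T -> periodic df T.
Proof.
move=> fd pf z.
have h : has_deriv (fun y => f (y + T)) z (df (z + T)).
  apply: has_deriv_eq.
    apply: (@der_comp _ f (fun y => y + T)); first exact: fd.
    by der.
  by rewrite /= addr0 mulr1.
rewrite (_ : (fun y => _) = f) in h; last exact/funext/pf.
have [_ <-] := h; by have [_ ->] := fd z.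
Qed.

End FourierDerivative.

(** * Fourier modes of a decaying solution in the half-plane *)

Section HalfPlaneModes.
Variable R : realType.
Variables (u ux uz uxx uzz : R -> R -> R) (ky c k : R).
Hypotheses (c_gt0 : 0 < c)
  (cu : joint_continuous [set x | x <= 0] u)
  (cux : joint_continuous [set x | x <= 0] ux)
  (cuxx : joint_continuous [set x | x < 0] uxx)
  (cuz : forall x, x < 0 -> continuous (uz x))
  (cuzz : forall x, x < 0 -> continuous (uzz x))
  (dux : forall x z, x < 0 -> has_deriv (u^~ z) x (ux x z))
  (duxx : forall x z, x < 0 -> has_deriv (ux^~ z) x (uxx x z))
  (duz : forall x z, x < 0 -> has_deriv (u x) z (uz x z))
  (duzz : forall x z, x < 0 -> has_deriv (uz x) z (uzz x z))
  (per : forall x, x <= 0 -> periodic (u x) (2 * pi))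
  (pde : forall x z, x < 0 ->
     uxx x z = (- ky ^+ 2) * uzz x z + (- c * ux x z + k * c * uz x z))
  (van : forall e, 0 < e -> exists M, forall x, x < M ->
     forall z, 0 <= z <= 2 * pi -> `|u x z| <= e).

Let tau_ge0 : 0 <= 2 * pi :> R.
Proof. by rewrite mulr_ge0// pi_ge0. Qed.

Let vanishes_coef (h : R -> R) : continuous h -> (forall z, `|h z| <= 1) ->
  vanishes_at_ninfty (fun x => segint 0 (2 * pi) (fun z => u x z * h z)).
Proof.
move=> ch h1 e e0.
pose e' := e / (1 + 2 * pi).
have k0 : 0 < 1 + 2 * pi :> R by rewrite ltr_pwDl.
have e'0 : 0 < e' by rewrite divr_gt0.
have [M HM] := van e'0.
exists (Num.min M 0) => x; rewrite lt_min => /andP[xM x0].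
have cux0 := joint_continuous_at cu (ltW x0 : [set x | x <= 0] x).
have bnd z : 0 <= z <= 2 * pi -> `|u x z * h z| <= e'.
  by move=> zI; rewrite normrM -[leRHS]mulr1 ler_pM// HM.
apply: (le_lt_trans (ler_norm_segint_cst tau_ge0 _ bnd)); first by cont.
by rewrite subr0 /e' mulrAC ltr_pdivrMr// ltr_pM2l//; lra.
Qed.

(** Integration by parts moves the zeta-derivatives of the equation onto cosine and sine, which
    leaves the system of [decaying_mode_first_order]. *)
Lemma mode_relation_interior n a b x : 0 <= a ->
  a ^+ 2 - b ^+ 2 + c * a = ky ^+ 2 * n%:R ^+ 2 ->
  2 * a * b + c * b = k * c * n%:R -> x < 0 ->
  cos_coef (ux x) n%:R = a * cos_coef (u x) n%:R + b * sin_coef (u x) n%:R /\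
  sin_coef (ux x) n%:R = a * sin_coef (u x) n%:R - b * cos_coef (u x) n%:R.
Proof.
move=> a0 e1 e2.
have ccos : continuous (fun z : R => cos (n%:R * z)) by cont.
have csin : continuous (fun z : R => sin (n%:R * z)) by cont.
have cu0 y : y < 0 -> continuous (u y).
  by move=> y0; exact: (joint_continuous_at cu (ltW y0 : [set x | x <= 0] y)).
have cux0 y : y < 0 -> continuous (ux y).
  by move=> y0; exact: (joint_continuous_at cux (ltW y0 : [set x | x <= 0] y)).
have cux' : joint_continuous [set x | x < 0] ux.
  by apply: continuous_subspaceW cux => -[y z] [/= y0 _]; split=> //=; exact: ltW.
have pz y : y < 0 -> periodic (uz y) (2 * pi).
  by move=> y0; apply: (periodic_deriv (fun z => duz z y0)); apply: per; exact: ltW.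
apply: (@decaying_mode_first_order _ (fun y => cos_coef (u y) n%:R)
   (fun y => cos_coef (ux y) n%:R) (fun y => cos_coef (uxx y) n%:R)
   (fun y => sin_coef (u y) n%:R) (fun y => sin_coef (ux y) n%:R)
   (fun y => sin_coef (uxx y) n%:R) a b c a0 c_gt0).
- by move=> y y0; exact: has_deriv_segint.
- by move=> y y0; exact: has_deriv_segint.
- by move=> y y0; exact: has_deriv_segint.
- by move=> y y0; exact: has_deriv_segint.
- move=> y y0; rewrite e1 e2.
  have -> : cos_coef (uxx y) n%:R = cos_coef (fun z => (- ky ^+ 2) * uzz y z +
      1 * (- c * ux y z + k * c * uz y z)) n%:R.
    by congr (cos_coef _ _); apply/funext => z; rewrite pde// mul1r.
  have h1 := cuz y0; have h2 := cuzz y0; have h3 := cux0 _ y0.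
  rewrite cos_coef_lin//; last by cont.
  rewrite cos_coef_lin// (cos_coef_deriv n h1 (fun z => duz z y0)); last first.
    exact/per/ltW.
  rewrite (cos_coef_deriv n h2 (fun z => duzz z y0)); last exact: pz.
  rewrite (sin_coef_deriv n h1 (fun z => duz z y0)); last exact/per/ltW.
  ring.
- move=> y y0; rewrite e1 e2.
  have -> : sin_coef (uxx y) n%:R = sin_coef (fun z => (- ky ^+ 2) * uzz y z +
      1 * (- c * ux y z + k * c * uz y z)) n%:R.
    by congr (sin_coef _ _); apply/funext => z; rewrite pde// mul1r.
  have h1 := cuz y0; have h2 := cuzz y0; have h3 := cux0 _ y0.
  rewrite sin_coef_lin//; last by cont.
  rewrite sin_coef_lin// (sin_coef_deriv n h1 (fun z => duz z y0)); last first.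
    exact/per/ltW.
  rewrite (sin_coef_deriv n h2 (fun z => duzz z y0)); last exact: pz.
  rewrite (cos_coef_deriv n h1 (fun z => duz z y0)); last exact/per/ltW.
  ring.
- by apply: vanishes_coef => // z; exact: cos_max.
- by apply: vanishes_coef => // z; exact: sin_max.
Qed.


(** Passage to the limit x -> 0 from the left, by continuity of [u] and [ux] up to the boundary. The
    weights are left free to serve both the cosine and the sine relation. *)
Lemma relation_at_boundary (h1 h2 h3 : R -> R) (a b : R) :
  continuous h1 -> continuous h2 -> continuous h3 ->
  (forall x, x < 0 -> segint 0 (2 * pi) (fun z => ux x z * h1 z) =
     a * segint 0 (2 * pi) (fun z => u x z * h2 z) +
     b * segint 0 (2 * pi) (fun z => u x z * h3 z)) ->
  segint 0 (2 * pi) (fun z => ux 0 z * h1 z) =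
     a * segint 0 (2 * pi) (fun z => u 0 z * h2 z) +
     b * segint 0 (2 * pi) (fun z => u 0 z * h3 z).
Proof.
move=> ch1 ch2 ch3 H; apply/eqP; rewrite -subr_eq0 -normr_le0.
apply/ler_addgt0Pr => e e0; rewrite add0r.
pose K := 1 + `|a| + `|b|.
have K0 : 0 < K by rewrite /K; have := normr_ge0 a; have := normr_ge0 b; lra.
have e'0 : 0 < e / K by rewrite divr_gt0.
have z0 : [set x : R | x <= 0] 0 by rewrite /=.
have [d1 d10 H1] := segint_parameter_continuous tau_ge0 ch1 cux z0 e'0.
have [d2 d20 H2] := segint_parameter_continuous tau_ge0 ch2 cu z0 e'0.
have [d3 d30 H3] := segint_parameter_continuous tau_ge0 ch3 cu z0 e'0.
pose d := Num.min d1 (Num.min d2 d3) / 2.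
have d0 : 0 < Num.min d1 (Num.min d2 d3) by rewrite !lt_min d10 d20.
have xn : - d < 0 by rewrite oppr_lt0 divr_gt0.
have : `|- d - 0| < Num.min d1 (Num.min d2 d3).
  by rewrite subr0 normrN gtr0_norm ?divr_gt0// /d; lra.
rewrite !lt_min => /and3P[xd1 xd2 xd3].
have := H1 (- d) (ltW xn) xd1; have := H2 (- d) (ltW xn) xd2.
have := H3 (- d) (ltW xn) xd3; rewrite (H _ xn).
set I1 := segint _ _ _; set I2 := segint _ _ _.
set J1 := segint _ _ _; set J2 := segint _ _ _; set L := segint _ _ _.
move=> le3 le2 le1.
have -> : L - (a * J2 + b * I2) = - (a * J1 + b * I1 - L) + a * (J1 - J2) + b * (I1 - I2).
  by ring.
have -> : e = e / K + `|a| * (e / K) + `|b| * (e / K).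
  by rewrite /K; field; rewrite gt_eqF.
rewrite (le_trans (ler_normD _ _))// lerD//; last by rewrite normrM ler_wpM2l.
rewrite (le_trans (ler_normD _ _))// lerD//; last by rewrite normrM ler_wpM2l.
by rewrite normrN.
Qed.

Lemma mode_relation n a b : 0 <= a ->
  a ^+ 2 - b ^+ 2 + c * a = ky ^+ 2 * n%:R ^+ 2 ->
  2 * a * b + c * b = k * c * n%:R ->
  cos_coef (ux 0) n%:R = a * cos_coef (u 0) n%:R + b * sin_coef (u 0) n%:R /\
  sin_coef (ux 0) n%:R = a * sin_coef (u 0) n%:R - b * cos_coef (u 0) n%:R.
Proof.
move=> a0 e1 e2; have H := mode_relation_interior a0 e1 e2.
have ccos : continuous (fun z : R => cos (n%:R * z)) by cont.
have csin : continuous (fun z : R => sin (n%:R * z)) by cont.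
split; first by apply: relation_at_boundary => // x x0; exact: (H x x0).1.
rewrite -mulNr; apply: relation_at_boundary => // x x0.
by rewrite mulNr; exact: (H x x0).2.
Qed.

(** Mode 0, whose root is nu = 0. *)
Lemma mean_ux0 : segint 0 (2 * pi) (ux 0) = 0.
Proof.
have [|//|+ _] := @mode_relation 0 0 0 (lexx 0); [by ring|by ring|].
rewrite !mul0r addr0 /cos_coef => E; rewrite -[RHS]E.
by apply: eq_segint => z _; rewrite mul0r cos0 mulr1.
Qed.

(** For x < 0 the mean of [u x] has derivative 0 and tends to 0 at -oo, so it vanishes; continuity
    extends this to x = 0. *)
Lemma mean_u0 : segint 0 (2 * pi) (u 0) = 0.
Proof.
pose A x := cos_coef (u x) 0.
have H x : x < 0 -> cos_coef (ux x) 0 = 0.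
  move=> x0; have [|//|+ _] := @mode_relation_interior 0 0 0 _ (lexx 0) _ _ x0;
    [by ring|by ring|by rewrite !mul0r addr0].
have c1 : continuous ((fun z => cos (0 * z)) : R -> R) by cont.
have dA x : x < 0 -> has_deriv A x 0.
  move=> x0; rewrite -(H x x0); apply: has_deriv_segint => //.
  - by apply: continuous_subspaceW cux => -[y z] [/= y0 _]; split=> //=; exact: ltW.
  - by move=> y y0; exact: (joint_continuous_at cu (ltW y0 : [set x | x <= 0] y)).
have A0 x : x < 0 -> A x = 0.
  move=> x0; apply/eqP; rewrite -normr_le0; apply/ler_addgt0Pr => e e0.
  have [//|z|M HM] := @vanishes_coef (fun z => cos (0 * z)) _ _ e e0.
    exact: cos_max.
  pose y := Num.min M x - 1.
  have yx : y < x by rewrite /y ltrBlDr gt_min; apply/orP; right; lra.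
  have yM : y < M by rewrite /y ltrBlDr gt_min; apply/orP; left; lra.
  have dA' t : y <= t <= x -> has_deriv A t 0 by move=> /andP[_ tx]; apply: dA; lra.
  have [t _] := has_deriv_MVT yx dA'; rewrite mul0r => /eqP; rewrite subr_eq0 => /eqP ->.
  by rewrite add0r ltW// HM.
have : A 0 = 0.
  apply/eqP; rewrite -normr_le0; apply/ler_addgt0Pr => e e0.
  have z0 : [set x : R | x <= 0] 0 by rewrite /=.
  have [d d0 Hd] := segint_parameter_continuous tau_ge0 c1 cu z0 e0.
  have xn : - (d / 2) < 0 by rewrite oppr_lt0 divr_gt0.
  have := Hd (- (d / 2)) (ltW xn); rewrite subr0 normrN gtr0_norm ?divr_gt0//.
  rewrite -/(cos_coef _ _) -/(cos_coef _ _) -/(A _) -/(A _) A0// sub0r normrN add0r.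
  by apply; lra.
rewrite /A /cos_coef => E; rewrite -[RHS]E.
by apply: eq_segint => z _; rewrite mul0r cos0 mulr1.
Qed.

End HalfPlaneModes.

(** * Estimates at the boundary *)

Section HalfPlaneCalculus.
Variable R : realType.
Implicit Types (phi : R -> R -> R) (x z : R).

Lemma derivable_x_has_deriv phi x z : x < 0 -> derivable_x phi x z ->
  has_deriv (phi^~ z) x (dx phi x z).
Proof.
move=> x0; rewrite /derivable_x => cq.
have {}cq : quotient_x phi x z y @[y --> within [set y | y <= 0] x^'] -->
    dx phi x z := cq.
apply: has_derivP => e e0.
have /cvgrPdist_le /(_ _ e0) [d /= d0 Hd] := cq.
exists (Num.min d (- x)); first by rewrite lt_min d0 oppr_gt0.
move=> y yx; rewrite lt_min => /andP[yd yx0].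
have yx1 : y - x != 0 by rewrite subr_eq0.
have y0 : y <= 0 by move: yx0; rewrite ltr_norml => /andP[_]; lra.
have := Hd y; rewrite /= distrC => /(_ yd yx y0); rewrite /quotient_x => {}Hd.
rewrite (_ : _ - _ = - ((dx phi x z - (phi y z - phi x z) / (y - x)) * (y - x)));
  last by field.
by rewrite normrN normrM ler_wpM2r.
Qed.

Lemma joint_continuousB (D : set R) phi psi : joint_continuous D phi ->
  joint_continuous D psi -> joint_continuous D (fun x z => phi x z - psi x z).
Proof. by move=> cphi cpsi p; apply: cvgB; [exact: cphi|exact: cpsi]. Qed.

Lemma derivable_z_has_deriv phi x z : derivable_z phi x z ->
  has_deriv (phi x) z (dz phi x z).
Proof. by move=> d; split=> //; rewrite /dz derive1E. Qed.

Lemma increasing_deriv_ge0 (f df : R -> R) : (forall x, has_deriv f x (df x)) ->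
  (forall y z, y < z -> f y < f z) -> forall x, 0 <= df x.
Proof.
move=> fd mf x; have [_ <-] := fd x; rewrite -derive1E.
apply: (@incr_derive1_ge0 _ f setT); last by rewrite interiorT.
- by move=> y _; have [] := fd y.
- by move=> y z _ _; exact: mf.
Qed.

(** Monotone functions that converge pointwise to a continuous one converge uniformly on segments:
    near [z], the values are squeezed between those at [z - e / 4] and [z + e / 4]. *)
Lemma uniform_vanishing phi (k : R) :
  (forall x z1 z2, x <= 0 -> z1 < z2 -> phi x z1 < phi x z2) ->
  (forall z, `|phi x z - (k * x + z)| @[x --> -oo] --> (0 : R)) ->
  forall e, 0 < e -> exists M, forall x, x < M ->
    forall z, 0 <= z <= 2 * pi -> `|phi x z - k * x - z| <= e.
Proof.
move=> mphi vphi e e0.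
have e40 : 0 < e / 4 by rewrite divr_gt0.
pose P x z := `|phi x z - k * x - z| <= e.
have /compact_near_coveringP /(_ R (ninfty_nbhs R) P _) := @segment_compact R 0 (2 * pi).
case; last first.
  move=> M [_ HM]; exists M => x xM z zI; apply: (HM x xM).
  by rewrite /= in_itv.
move=> z _.
have /cvgrPdist_lt /(_ _ e40) [M1 [_ HM1]] := vphi (z + e / 4).
have /cvgrPdist_lt /(_ _ e40) [M2 [_ HM2]] := vphi (z - e / 4).
pose M := Num.min 0 (Num.min M1 M2).
exists (ball z (e / 4), [set x | x < M]) => /=.
  split; first by exists (e / 4).
  by exists M; split => //; exact: num_real.
move=> [z' x] /= [zz']; rewrite !lt_min => /and3P[x0 xM1 xM2].
have := HM1 x xM1; have := HM2 x xM2.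
rewrite /= !sub0r !normrN !normr_id !ltr_norml => /andP[l1 _] /andP[_ l2].
move: zz'; rewrite /ball/= ltr_norml => /andP[z1 z2].
have h1 : z - e / 4 < z' by lra.
have h2 : z' < z + e / 4 by lra.
have h3 := mphi x _ _ (ltW x0) h1; have h4 := mphi x _ _ (ltW x0) h2.
by rewrite /P ler_norml; lra.
Qed.

End HalfPlaneCalculus.

(** * The residual of the boundary trace *)

Section BoundaryEstimate.
Variables (R : realType) (g dg : R -> R) (K1 K2 G1 ky c k : R).
Variable phi : R -> R -> R.
Hypotheses (g_deriv : forall v, has_deriv g v (dg v)) (cdg : continuous dg)
  (g_periodic : periodic g (2 * pi))
  (K1_gt0 : 0 < K1) (g_bound : forall v, K1 <= g v <= K2)
  (dg_bound : forall v, `|dg v| <= G1)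
  (ky_gt0 : 0 < ky) (c_gt0 : 0 < c)
  (sol : monotone_solution g ky c k phi).

Let tau_ge0 : 0 <= 2 * pi :> R.
Proof. by rewrite mulr_ge0// pi_ge0. Qed.

Let psi := phi 0.
Let dpsi := dz phi 0.

Lemma psi_deriv z : has_deriv psi z (dpsi z).
Proof.
have [[[_ d _ _] _ _] _ _] := sol.
by apply: derivable_z_has_deriv; have [] := d 0 z (lexx 0).
Qed.

Lemma cont_dpsi : continuous dpsi.
Proof.
have [[[_ _ _ cz] _ _] _ _] := sol.
exact: (joint_continuous_at cz (lexx 0 : [set x : R | x <= 0] 0)).
Qed.

Lemma cont_psi : continuous psi.
Proof. exact: der_continuous psi_deriv. Qed.

Lemma psi_shift z : psi (z + 2 * pi) = psi z + 2 * pi.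
Proof. by have [_ [_ /(_ 0 z (lexx 0)) h _ _] _] := sol; rewrite /psi; lra. Qed.

Lemma dpsi_periodic : periodic dpsi (2 * pi).
Proof.
have d z : has_deriv (fun z => psi z - z) z (dpsi z - 1).
  by have h := psi_deriv z; apply: has_deriv_eq; [der|].
have pp : periodic (fun z => psi z - z) (2 * pi).
  by move=> z; rewrite psi_shift; ring.
by move=> z; have := periodic_deriv d pp z; lra.
Qed.

Lemma dpsi_ge0 z : 0 <= dpsi z.
Proof.
by apply: (increasing_deriv_ge0 psi_deriv) => y t; have [_ _ m] := sol; exact: m.
Qed.

Let u x z := phi x z - k * x - z.
Let ux x z := dx phi x z - k.
Let uz x z := dz phi x z - 1.
Let uxx := dx (dx phi).
Let uzz := dz (dz phi).

Let cu : joint_continuous [set x | x <= 0] u.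
Proof.
have [[[cphi _ _ _] _ _] _ _] := sol.
apply: joint_continuousB; last first.
  by apply: continuous_subspaceT => q; exact: cvg_snd.
apply: joint_continuousB; first exact: cphi.
by apply: continuous_subspaceT => q; apply: cvgM; [exact: cvg_cst|exact: cvg_fst].
Qed.

Let cux : joint_continuous [set x | x <= 0] ux.
Proof.
have [[[_ _ cx _] _ _] _ _] := sol.
apply: joint_continuousB; first exact: cx.
by apply: continuous_subspaceT => q; exact: cvg_cst.
Qed.

Let cuxx : joint_continuous [set x | x < 0] uxx.
Proof. by have [[_ [_ _ h _] _] _ _] := sol. Qed.

Let cuz x : x < 0 -> continuous (uz x).
Proof.
have [[[_ _ _ cz] _ _] _ _] := sol => x0.
have h := joint_continuous_at cz (ltW x0 : [set x | x <= 0] x).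
by rewrite /uz; cont.
Qed.

Let cuzz x : x < 0 -> continuous (uzz x).
Proof.
have [[_ _ [_ _ _ h]] _ _] := sol => x0.
exact: (joint_continuous_at h (x0 : [set x | x < 0] x)).
Qed.

Let dux x z : x < 0 -> has_deriv (u^~ z) x (ux x z).
Proof.
have [[[_ d _ _] _ _] _ _] := sol => x0.
have h := derivable_x_has_deriv x0 (d x z (ltW x0)).1.
by apply: has_deriv_eq; [rewrite /u; der|rewrite /ux /=; ring].
Qed.

Let duxx x z : x < 0 -> has_deriv (ux^~ z) x (uxx x z).
Proof.
have [[_ [_ d _ _] _] _ _] := sol => x0.
have h := derivable_x_has_deriv x0 (d x z x0).1.
by apply: has_deriv_eq; [rewrite /ux; der|rewrite /uxx /=; ring].
Qed.

Let duz x z : x < 0 -> has_deriv (u x) z (uz x z).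
Proof.
have [[[_ d _ _] _ _] _ _] := sol => x0.
have h := derivable_z_has_deriv (d x z (ltW x0)).2.
by apply: has_deriv_eq; [rewrite /u; der|rewrite /uz /=; ring].
Qed.

Let duzz x z : x < 0 -> has_deriv (uz x) z (uzz x z).
Proof.
have [[_ _ [_ d _ _]] _ _] := sol => x0.
have h := derivable_z_has_deriv (d x z x0).2.
by apply: has_deriv_eq; [rewrite /uz; der|rewrite /uzz /=; ring].
Qed.

Let per x : x <= 0 -> periodic (u x) (2 * pi).
Proof.
by move=> x0 z; have [_ [_ /(_ x z x0) h _ _] _] := sol; rewrite /u; lra.
Qed.

Let pde x z : x < 0 ->
  uxx x z = (- ky ^+ 2) * uzz x z + (- c * ux x z + k * c * uz x z).
Proof.
by move=> x0; have [_ [/(_ x z x0) h _ _ _] _] := sol;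
  rewrite /uxx /uzz /ux /uz; lra.
Qed.

Let van e : 0 < e -> exists M, forall x, x < M ->
  forall z, 0 <= z <= 2 * pi -> `|u x z| <= e.
Proof. by have [_ [_ _ _ v] m] := sol; exact: uniform_vanishing. Qed.

Let p z := g (psi z) - k.

Let ux0 : ux 0 = p.
Proof.
by apply/funext => z; have [_ [_ _ /(_ z) h _] _] := sol; rewrite /ux /p /psi; lra.
Qed.

Let u0 z : u 0 z = psi z - z.
Proof. by rewrite /u mulr0 subr0. Qed.

Let cont_g : continuous g.
Proof. exact: der_continuous g_deriv. Qed.

Let cont_gpsi : continuous (fun z => g (psi z)).
Proof. by apply: cont_comp => //; exact: cont_psi. Qed.

Lemma psi_mean : segint 0 (2 * pi) (fun z => psi z - z) = 0.
Proof.
rewrite -[RHS](mean_u0 c_gt0 cu cux cuxx cuz cuzz dux duxx duz duzz per pde van).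
by apply: eq_segint => z _; rewrite u0.
Qed.

Lemma gpsi_mean : segint 0 (2 * pi) (fun z => g (psi z)) = k * (2 * pi).
Proof.
have := mean_ux0 c_gt0 cu cux cuxx cuz cuzz dux duxx duz duzz per pde van.
rewrite ux0 /p segintB//; last by cont.
by rewrite segint_cst// subr0; lra.
Qed.

(** [k] is the mean of [g (psi z)] over a period. This makes the multiplier constant independent of
    [c]. *)
Lemma wavenumber_bound : K1 <= k <= K2.
Proof.
have t0 : 0 < 2 * pi :> R by rewrite mulr_gt0// pi_gt0.
have c1 := segint_cst K1 tau_ge0; have c2 := segint_cst K2 tau_ge0.
rewrite subr0 in c1 c2.
rewrite -[K1 <= k](ler_pM2r t0) -[k <= K2](ler_pM2r t0) -c1 -c2 -gpsi_mean.
apply/andP; split.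
  apply: le_segint => [||z _]; [exact: cont_cst|exact: cont_gpsi|].
  by have /andP[] := g_bound (psi z).
apply: le_segint => [||z _]; [exact: cont_gpsi|exact: cont_cst|].
by have /andP[] := g_bound (psi z).
Qed.

Let r z := g (psi z) - k * dpsi z.

Lemma cont_residual : continuous r.
Proof. have h := cont_dpsi; rewrite /r; cont. Qed.

Let du0 z : has_deriv (u 0) z (dpsi z - 1).
Proof.
have h := psi_deriv z; rewrite (_ : u 0 = fun z => psi z - z); last exact/funext/u0.
by apply: has_deriv_eq; [der|].
Qed.

Let p_deriv z : has_deriv p z (dg (psi z) * dpsi z).
Proof.
have h := der_comp (g_deriv (psi z)) (psi_deriv z).
by apply: has_deriv_eq; [rewrite /p; der|rewrite /= addr0].
Qed.

Let p_periodic : periodic p (2 * pi).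
Proof. by move=> z; rewrite /p psi_shift g_periodic. Qed.

(* [psi] is increasing, so [p] has bounded variation uniformly in [c]. *)
Let p_mode n : n%:R ^+ 2 * mode_energy p n%:R <= 2 * (G1 * (2 * pi)) ^+ 2.
Proof.
have cd := cont_dpsi; have cp := cont_psi.
have cdgp : continuous (fun z => dg (psi z)) by exact: cont_comp.
have cdp : continuous (fun z => dg (psi z) * dpsi z) by cont.
have bnd (h : R -> R) : continuous h -> (forall z, `|h z| <= 1) ->
    segint 0 (2 * pi) (fun z => dg (psi z) * dpsi z * h z) ^+ 2 <=
      (G1 * (2 * pi)) ^+ 2.
  move=> ch h1; rewrite -real_normK ?num_real//.
  have G10 : 0 <= G1 := le_trans (normr_ge0 _) (dg_bound 0).
  rewrite ler_sqr ?nnegrE ?mulr_ge0 ?pi_ge0//.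
  apply: le_trans (ler_norm_segint _ _ _) _; first by cont.
  (* As [dpsi >= 0], this is the total variation of [psi] over a period. *)
  have tE : segint 0 (2 * pi) dpsi = 2 * pi.
    by rewrite (segint_FTC tau_ge0 cd psi_deriv) -[X in psi X]add0r psi_shift; ring.
  rewrite -[X in _ <= G1 * X]tE -segintZ//; apply: le_segint; [cont|cont|] => z _.
  rewrite !normrM (ger0_norm (dpsi_ge0 z)) -mulrA.
  by rewrite ler_pM// ?mulr_ge0 ?dpsi_ge0// ler_piMr ?dpsi_ge0.
have cc : continuous (fun z : R => cos (n%:R * z)) by cont.
have cs : continuous (fun z : R => sin (n%:R * z)) by cont.
have := bnd _ cc (fun z => cos_max _); have := bnd _ cs (fun z => sin_max _).
rewrite -/(cos_coef _ _) -/(sin_coef _ _).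
rewrite (cos_coef_deriv n cdp p_deriv p_periodic).
rewrite (sin_coef_deriv n cdp p_deriv p_periodic).
by rewrite /mode_energy sqrrN !exprMn; lra.
Qed.

(** Frequency 0 is treated apart, since nu vanishes there: [g (psi z)] and [k * dpsi z] both have
    integral [k * (2 * pi)]. *)
Let r_mode0 : mode_energy r 0 = 0.
Proof.
have cd := cont_dpsi.
rewrite /mode_energy.
have -> : sin_coef r 0 = 0.
  rewrite -[RHS](mul0r (2 * pi - 0)) -segint_cst//; apply: eq_segint => z _.
  by rewrite mul0r sin0 mulr0.
have -> : cos_coef r 0 = segint 0 (2 * pi) r.
  by apply: eq_segint => z _; rewrite mul0r cos0 mulr1.
rewrite /r segintB//; last by cont.
rewrite segintZ// gpsi_mean (segint_FTC tau_ge0 cd psi_deriv).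
by rewrite -[X in psi X]add0r psi_shift; ring.
Qed.

Let W := multiplier_const ky K1 K2 * (2 * (G1 * (2 * pi)) ^+ 2).

(** The modes of [r] and [p] are those of [u 0] multiplied by nu - i k n and by nu. Multiplying
    [multiplier_bound] by the common energy of [u 0] compares them without a division by nu. *)
Let r_mode n : (0 < n)%N -> mode_energy r n%:R * (n%:R + c) ^+ 2 <= W.
Proof.
move=> n0; have w0 : 0 < n%:R :> R by rewrite ltr0n.
have cd := cont_dpsi; have cp := cont_psi.
have /andP[K1k kK2] := wavenumber_bound.
have kap0 : 0 <= ky ^+ 2 * n%:R ^+ 2 by rewrite mulr_ge0 ?sqr_ge0.
have [a [b [a0 e1 e2]]] := mode_root (k * c * n%:R) c_gt0 kap0.
have [A1 B1] := mode_relation c_gt0 cu cux cuxx cuz cuzz dux duxx duz duzz per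
  pde van a0 e1 e2.
rewrite ux0 in A1 B1.
have cdu : continuous (fun z => dpsi z - 1) by cont.
have cr : continuous p by rewrite /p; cont.
have rE : r = fun z => 1 * p z + (- k) * (dpsi z - 1).
  by apply/funext => z; rewrite /r /p; ring.
have Ar : cos_coef r n%:R = a * cos_coef (u 0) n%:R + (b - k * n%:R) * sin_coef (u 0) n%:R.
  rewrite rE cos_coef_lin// A1 (cos_coef_deriv n cdu du0); first by ring.
  exact: per.
have Br : sin_coef r n%:R = a * sin_coef (u 0) n%:R - (b - k * n%:R) * cos_coef (u 0) n%:R.
  rewrite rE sin_coef_lin// B1 (sin_coef_deriv n cdu du0); first by ring.
  exact: per.
have Er : mode_energy r n%:R = (a ^+ 2 + (b - k * n%:R) ^+ 2) * mode_energy (u 0) n%:R.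
  by rewrite /mode_energy Ar Br; ring.
have Ep : mode_energy p n%:R = (a ^+ 2 + b ^+ 2) * mode_energy (u 0) n%:R.
  by rewrite /mode_energy A1 B1; ring.
have := multiplier_bound ky_gt0 K1_gt0 K1k kK2 c_gt0 w0 a0 e1 e2.
move=> /(ler_wpM2r (mode_energy_ge0 (u 0) n%:R)) H.
rewrite Er mulrAC (le_trans H)//.
rewrite [leLHS](_ : _ = multiplier_const ky K1 K2 *
  (n%:R ^+ 2 * mode_energy p n%:R)); last by rewrite Ep; ring.
by rewrite ler_wpM2l// ltW// multiplier_const_gt0.
Qed.

Lemma residual_estimate :
  pi * segint 0 (2 * pi) (fun z => r z ^+ 2) <= W / c.
Proof.
have W0 : 0 <= W.
  by rewrite mulr_ge0 ?(ltW (multiplier_const_gt0 _ _ _))// mulr_ge0// sqr_ge0.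
apply: segint_sqr_le_modes; first exact: cont_residual.
  move=> z; rewrite /r dpsi_periodic; congr (_ - _).
  by have := p_periodic z; rewrite /p; lra.
(* The square of [(N + 1 + c)^-1] is at most [(N + c)^-1 - (N + 1 + c)^-1], and the term [m = 0] is
   zero. *)
have sum N : \sum_(m < N.+1) mode_energy r m%:R <= W * (c^-1 - (N%:R + c)^-1).
  elim: N => [|N IHN].
    by rewrite big_ord1 r_mode0 add0r subrr mulr0.
  rewrite big_ord_recr/=; apply: le_trans (lerD IHN (lexx _)) _.
  have x0 : 0 < N%:R + c by rewrite ltr_wpDl.
  have x1 : 0 < N.+1%:R + c by rewrite ltr_wpDl.
  have : mode_energy r N.+1%:R <= W / (N.+1%:R + c) ^+ 2.
    by rewrite ler_pdivlMr ?exprn_gt0// r_mode.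
  have : W / (N.+1%:R + c) ^+ 2 <= W * ((N%:R + c)^-1 - (N.+1%:R + c)^-1).
    rewrite ler_wpM2l//.
    have -> : (N%:R + c)^-1 - (N.+1%:R + c)^-1 = ((N%:R + c) * (N.+1%:R + c))^-1.
      by rewrite -natr1; field; rewrite natr1 !gt_eqF.
    by rewrite lef_pV2 ?posrE ?exprn_gt0 ?mulr_gt0// expr2 ler_wpM2r ?(ltW x1)//
      lerD2r ler_nat.
  by lra.
case=> [|N]; first by rewrite big_ord0 divr_ge0// ltW.
apply: (le_trans (sum N)); rewrite ler_wpM2l// gerBl invr_ge0.
by rewrite addr_ge0// ltW.
Qed.

End BoundaryEstimate.

(** * The limit profile and its stability *)

Section Primitives.
Variable R : realType.
Implicit Types (f df h : R -> R) (a b c x y : R).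

Lemma segint_chasles a b c h : continuous h -> a <= b -> b <= c ->
  segint a c h = segint a b h + segint b c h.
Proof.
move=> ch ab bc.
have := @Rintegral_itvB R h (BLeft a) (BRight c) b (continuous_integrable a c ch).
rewrite !bnd_simp => /(_ ab bc).
rewrite Rintegral_itv_obnd_cbnd.
  by rewrite /segint => <-; ring.
apply: integrableS (continuous_integrable b c ch) => //.
exact: subset_itv_oc_cc.
Qed.

Lemma le_segint_sub a b c h : continuous h -> (forall x, 0 <= h x) ->
  a <= b -> b <= c -> segint a b h <= segint a c h.
Proof.
by move=> ch h0 ab bc; rewrite (segint_chasles ch ab bc) lerDl segint_ge0.
Qed.

Lemma near_has_deriv f h x d : (\forall y \near x, f y = h y) ->
  has_deriv f x d -> has_deriv h x d.
Proof. by move=> fh fd; exact: (near_eq_is_derive fh fd). Qed.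

(** The lower limit of integration must stay below both [x] and 0, so it moves with [x]; subtracting
    the integral up to 0 makes the value independent of it. *)
Lemma primitive_exists h : continuous h ->
  exists H : R -> R, forall x, has_deriv H x (h x).
Proof.
move=> ch; pose H x := segint (- (`|x| + 1)) x h - segint (- (`|x| + 1)) 0 h.
exists H => x.
have HE a y : a <= 0 -> a <= y -> segint a y h - segint a 0 h = H y.
  move=> a0 ay; rewrite /H; pose b := - (`|y| + 1); rewrite -/b.
  have b0 : b <= 0 by rewrite oppr_le0 addr_ge0.
  have yb : b <= y by rewrite /b; have := ler_norm (- y); rewrite normrN; lra.
  have [ab|/ltW ba] := leP a b.
    by rewrite (segint_chasles ch ab yb) (segint_chasles ch ab b0); ring.
  by rewrite (segint_chasles ch ba ay) (segint_chasles ch ba a0); ring.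
pose a := - (`|x| + 1).
have a0 : a <= 0 by rewrite oppr_le0 addr_ge0.
have ax : a < x by rewrite /a; have := ler_norm (- x); rewrite normrN; lra.
apply: (@near_has_deriv (fun y => segint a y h - segint a 0 h)).
  have : \forall y \near x, a < y by exact: lt_nbhsr.
  by apply: filterS => y ay; apply: HE => //; exact: ltW.
have x1 : x < x + 1 by rewrite ltrDl.
have [d dE] := continuous_FTC1_closed x1 (continuous_integrable a (x + 1) ch) ax (ch x).
have dI : has_deriv (fun y => segint a y h) x (h x).
  by split; [exact: d|rewrite -derive1E; exact: dE].
by apply: has_deriv_eq; [der|rewrite /= addr0].
Qed.

Lemma constant_of_deriv0 f : (forall x, has_deriv f x 0) -> forall x y, f x = f y.
Proof. by move=> fd x y; apply: is_derive_0_is_cst => z; exact: fd. Qed.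

Lemma lipschitz_of_deriv f df (L : R) : (forall x, has_deriv f x (df x)) ->
  (forall x, `|df x| <= L) -> forall x y, `|f x - f y| <= L * `|x - y|.
Proof.
move=> fd dL.
have main x y : x < y -> `|f y - f x| <= L * `|y - x|.
  move=> xy; have [z _ ->] := has_deriv_MVT xy (fun z _ => fd z).
  by rewrite normrM ler_wpM2r.
move=> x y; have [xy|yx|->] := ltgtP x y.
- by rewrite distrC [`|x - y|]distrC; exact: main.
- exact: main.
- by rewrite !subrr normr0 mulr0.
Qed.

(** For a primitive [F], the increment [F (y + T) - F y] has derivative 0. *)
Lemma segint_periodic_shift f (T s : R) : 0 <= T -> continuous f -> periodic f T ->
  segint 0 T (fun z => f (z + s)) = segint 0 T f.
Proof.
move=> T0 cf pf; have [F dF] := primitive_exists cf.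
have dshift (t : R) x : has_deriv (fun y => F (y + t)) x (f (x + t)).
  apply: has_deriv_eq.
    by apply: (@der_comp _ F (fun y => y + t)); [exact: dF|der].
  by rewrite /= addr0 mulr1.
rewrite (segint_FTC T0 cf dF) (segint_FTC T0 _ (dshift s)).
  have d0 x : has_deriv (fun y => F (y + T) - F y) x 0.
    have h1 := dshift T x; have h2 := dF x.
    by apply: has_deriv_eq; [der|rewrite /= pf subrr].
  by have /= := constant_of_deriv0 d0 s 0; rewrite !add0r [s + T]addrC.
by apply: cont_comp => //; cont.
Qed.

Lemma segint_cauchy_schwarz a b f : a < b -> continuous f ->
  segint a b (fun x => `|f x|) ^+ 2 <= (b - a) * segint a b (fun x => f x ^+ 2).
Proof.
move=> ab cf; set P := segint _ _ _; set Q := segint _ _ _.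
have P0 : 0 <= P by apply: segint_ge0.
have Q0 : 0 <= Q by apply: segint_ge0 => x _; exact: sqr_ge0.
move: P0; rewrite le_eqVlt => /predU1P[<-|P0].
  by rewrite expr0n/= mulr_ge0// subr_ge0 ltW.
have l0 : 0 < b - a by rewrite subr_gt0.
(* With this parameter the constant term of [segint_sqr_le] equals [P / 2]. *)
have t0 : 0 < (b - a) / (2 * P) by rewrite divr_gt0// mulr_gt0.
have := segint_sqr_le (ltW ab) cf t0; rewrite -/P -/Q.
have -> : (b - a) / (4 * ((b - a) / (2 * P))) = P / 2.
  by field; rewrite !gt_eqF.
have -> : (b - a) / (2 * P) * Q = (b - a) * Q / (2 * P) by field; rewrite gt_eqF.
move=> h; have : P / 2 <= (b - a) * Q / (2 * P) by lra.
by rewrite ler_pdivlMr ?mulr_gt0//; lra.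
Qed.

(** A slope of at least [m] makes [f] onto: on [[- c, c]] it moves away from [f 0] by at least
    [|t - f 0| + 1] on each side, so the intermediate value theorem reaches [t]. *)
Lemma right_inverse_exists f df (m : R) : 0 < m ->
  (forall x, has_deriv f x (df x)) -> (forall x, m <= df x) ->
  exists q : R -> R, cancel q f.
Proof.
move=> m0 fd dm; have cf := der_continuous fd.
have grow x y : x < y -> m * (y - x) <= f y - f x.
  move=> xy; have [z _ ->] := has_deriv_MVT xy (fun z _ => fd z).
  by rewrite ler_wpM2r// subr_ge0 ltW.
suff onto t : exists x, f x = t.
  by exists (fun t => projT1 (cid (onto t))) => t; case: cid.
pose c := (`|t - f 0| + 1) / m.
have c0 : 0 < c by rewrite divr_gt0// ltr_wpDl.
have mc : m * c = `|t - f 0| + 1 by rewrite /c; field; rewrite gt_eqF.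
have h1 := grow _ _ c0; have cn : - c < 0 by rewrite oppr_lt0.
have h2 := grow _ _ cn; rewrite sub0r opprK mc in h2; rewrite subr0 mc in h1.
have n1 := ler_norm (t - f 0); have n2 := ler_norm (- (t - f 0)); rewrite normrN in n2.
have cc : - c <= c by lra.
have [||x _ <-] := @IVT R f (- c) c t cc.
- exact: continuous_subspaceT.
- by rewrite ge_min le_max; apply/andP; split; apply/orP; [left|right]; lra.
- by exists x.
Qed.

End Primitives.

(** The linear combination that closes [profile_stability]: [x] and [y] are the squared errors of
    the profile and of its derivative at a point, [e] is [eta ^+ 2], and [r] is the squared residual
    over [K1 ^+ 2]. *)
Lemma energy_bookkeeping (R : realFieldType) (C A S e r x y a b s : R) :
  x <= C * e -> y <= 3 * (a + b + s) -> a <= A * e -> b <= r -> s <= S * e ->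
  x + y <= (C + 3 * (A + S)) * e + 3 * r.
Proof. by lra. Qed.

(** * The limit equation solved by quadrature *)

Section LimitProfile.
Variables (R : realType) (g dg : R -> R) (K1 K2 G1 : R) (G q0 : R -> R).
Hypotheses (g_deriv : forall v, has_deriv g v (dg v))
  (g_periodic : periodic g (2 * pi))
  (K1_gt0 : 0 < K1) (g_bound : forall v, K1 <= g v <= K2)
  (dg_bound : forall v, `|dg v| <= G1)
  (G_deriv : forall v, has_deriv G v (g v)^-1) (Gq0 : cancel q0 G).

Let tau : R := 2 * pi.

Let tau_gt0 : 0 < tau.
Proof. by rewrite mulr_gt0// pi_gt0. Qed.

Let tau_ge0 : 0 <= tau := ltW tau_gt0.

Let g_gt0 v : 0 < g v.
Proof. by have /andP[h _] := g_bound v; exact: lt_le_trans h. Qed.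

Let K2_gt0 : 0 < K2.
Proof.
by have /andP[Kg gK] := g_bound 0; exact: lt_le_trans (lt_le_trans K1_gt0 Kg) gK.
Qed.

Let cont_g : continuous g := der_continuous g_deriv.

Let cont_gV : continuous (fun v => (g v)^-1).
Proof. by apply: contV => // v; rewrite gt_eqF. Qed.

Let G_incr x y : x < y -> G x < G y.
Proof.
move=> xy; rewrite -subr_gt0.
have [z _ ->] := has_deriv_MVT xy (fun z _ => G_deriv z).
by rewrite mulr_gt0 ?invr_gt0// subr_gt0.
Qed.

Let G_inj : injective G.
Proof.
move=> x y Gxy; apply/eqP; rewrite eq_le !leNgt.
by apply/andP; split; apply/negP => /G_incr; rewrite Gxy ltxx.
Qed.

Let q0G : cancel G q0.
Proof. by move=> v; apply: G_inj; rewrite Gq0. Qed.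

Let q0_deriv t : has_deriv q0 t (g (q0 t)).
Proof.
rewrite -{1}(Gq0 t) -(invrK (g (q0 t))).
apply: (@is_derive_inverse _ G q0).
- have h : \forall x \near q0 t, q0 (G x) = x by exact: filterE q0G.
  exact: h.
- have h : \forall x \near q0 t, {for x, continuous G}.
    by apply: filterE; exact: (der_continuous G_deriv).
  exact: h.
- exact: G_deriv.
- by rewrite invr_neq0// gt_eqF.
Qed.

(** Time in which the solution [q0] of q' = g(q) advances by [2 * pi]. *)
Definition period_time : R := segint 0 (2 * pi) (fun v => (g v)^-1).

Let T_gt0 : 0 < period_time.
Proof.
apply: (@lt_le_trans _ _ (segint 0 tau (fun=> K2^-1))).
  by rewrite segint_cst// subr0 mulr_gt0 ?invr_gt0.
apply: le_segint => [|//|v _]; first by cont.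
by rewrite lef_pV2 ?posrE//; have /andP[] := g_bound v.
Qed.

Let G_shift v : G (v + tau) = G v + period_time.
Proof.
have d x : has_deriv (fun v => G (v + tau) - G v) x 0.
  have h1 := G_deriv x.
  have h2 : has_deriv (fun v => G (v + tau)) x (g (x + tau))^-1.
    apply: has_deriv_eq.
      by apply: (@der_comp _ G (fun y => y + tau)); [exact: G_deriv|der].
    by rewrite /= addr0 mulr1.
  by apply: has_deriv_eq; [der|rewrite /= g_periodic subrr].
have /= := constant_of_deriv0 d v 0; rewrite add0r.
by rewrite /period_time (segint_FTC tau_ge0 cont_gV G_deriv); lra.
Qed.

Definition limit_wavenumber : R := 2 * pi / period_time.

Lemma limit_wavenumber_gt0 : 0 < limit_wavenumber.
Proof. by rewrite divr_gt0. Qed.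

Let k0_gt0 : 0 < limit_wavenumber := limit_wavenumber_gt0.

Let Tk0 : period_time = tau / limit_wavenumber.
Proof. by rewrite /limit_wavenumber -/tau invf_div mulrCA divff ?mulr1 ?gt_eqF. Qed.

Let K1k0 : K1 <= limit_wavenumber.
Proof.
rewrite /limit_wavenumber ler_pdivlMr// -/tau.
have : segint 0 tau (fun v => (g v)^-1) <= segint 0 tau (fun=> K1^-1).
  apply: le_segint => [//||v _]; first by cont.
  by rewrite lef_pV2 ?posrE//; have /andP[] := g_bound v.
rewrite segint_cst// subr0 -/period_time => h.
by rewrite -ler_pdivlMl.
Qed.

(** Time rescaled so that an advance of [2 * pi] takes [2 * pi] in [z]. *)
Definition travel z : R := q0 (z / limit_wavenumber).

Let travel_deriv z : has_deriv travel z (g (travel z) / limit_wavenumber).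
Proof.
apply: has_deriv_eq.
  by apply: (@der_comp _ q0 (fun z => z / limit_wavenumber)); [exact: q0_deriv|der].
by rewrite /= mulr0 add0r mulr1.
Qed.

Let travel_shift z : travel (z + tau) = travel z + tau.
Proof.
by apply: G_inj; rewrite /travel G_shift !Gq0 Tk0 mulrDl.
Qed.

Definition phase : R := - segint 0 (2 * pi) (fun z => travel z - z) / (2 * pi).

Definition profile z : R := travel (z + phase).

Let cont_travel : continuous travel := der_continuous travel_deriv.

(** The mean is affine in the translation [s] with slope 1, so [phase] is the only translation with
    mean zero. *)
Let travel_mean s :
  segint 0 tau (fun z => travel (z + s) - z) = tau * (s - phase).
Proof.
have cts : continuous (fun z => travel (z + s)) by apply: cont_comp => //; cont.
have per : periodic (fun z => travel z - z) tau.
  by move=> z; rewrite travel_shift; ring.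
have cd : continuous (fun z => travel z - z) by cont.
have := segint_periodic_shift s tau_ge0 cd per.
rewrite (@eq_segint _ _ _ _ (fun z => (travel (z + s) - z) - s)); last first.
  by move=> z _; ring.
rewrite segintB; [|cont|cont]; rewrite segint_cst// subr0 => E.
have -> : phase = - (segint 0 tau (fun z => travel z - z)) / tau by [].
rewrite -E; field; exact: lt0r_neq0.
Qed.

Lemma profile_deriv z : has_deriv profile z (g (profile z) / limit_wavenumber).
Proof.
apply: has_deriv_eq.
  by apply: (@der_comp _ travel (fun z => z + phase)); [exact: travel_deriv|der].
by rewrite /= addr0 mulr1.
Qed.

Lemma profile_shift z : profile (z + 2 * pi) = profile z + 2 * pi.
Proof. by rewrite /profile addrAC travel_shift. Qed.

Lemma profile_mean : segint 0 (2 * pi) (fun z => profile z - z) = 0.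
Proof. by rewrite travel_mean subrr mulr0. Qed.

Let travelE z C : G (z) = C -> z = travel (limit_wavenumber * C).
Proof.
by move=> GC; apply: G_inj; rewrite /travel Gq0 mulrC mulKf// gt_eqF.
Qed.

(** [G (psi z)] grows at the constant rate [limit_wavenumber^-1], so [psi] is a translate of
    [travel]; the mean fixes the translation. *)
Lemma profile_unique (psi dpsi : R -> R) :
  (forall z, has_deriv psi z (dpsi z)) -> (forall z, limit_wavenumber * dpsi z = g (psi z)) ->
  segint 0 (2 * pi) (fun z => psi z - z) = 0 -> psi = profile.
Proof.
move=> dpsiE ode mean.
have dE z : has_deriv (fun z => G (psi z) - limit_wavenumber^-1 * z) z 0.
  have h := der_comp (G_deriv (psi z)) (dpsiE z).
  apply: has_deriv_eq; first by der.
  have dz0 : 0 < dpsi z by rewrite -(pmulr_rgt0 _ k0_gt0) ode.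
  by rewrite /= -ode; field; rewrite !gt_eqF.
pose C := G (psi 0).
have psiE z : psi z = travel (z + limit_wavenumber * C).
  have /= := constant_of_deriv0 dE z 0; rewrite mulr0 subr0 -/C => E.
  have {}E : G (psi z) = limit_wavenumber^-1 * z + C by lra.
  by rewrite (travelE E) mulrDr mulVKf// gt_eqF.
suff kC : limit_wavenumber * C = phase by apply/funext => z; rewrite psiE kC.
move: mean; rewrite (@eq_segint _ _ _ _ (fun z => travel (z + limit_wavenumber * C) - z)).
  rewrite travel_mean => /eqP; rewrite mulf_eq0 (gt_eqF tau_gt0)/= subr_eq0.
  by move/eqP.
by move=> z _; rewrite psiE.
Qed.

Section Stability.
Variables (psi dpsi : R -> R) (k : R).
Hypotheses (psi_deriv : forall z, has_deriv psi z (dpsi z))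
  (cdpsi : continuous dpsi) (psi_shift : forall z, psi (z + tau) = psi z + tau)
  (psi_mean : segint 0 tau (fun z => psi z - z) = 0)
  (k_bound : K1 <= k <= K2).

Let r z := g (psi z) - k * dpsi z.
Let rho2 := segint 0 tau (fun z => r z ^+ 2).
Let eta := segint 0 tau (fun z => `|r z|) / K1 ^+ 2.

Let cont_psi : continuous psi := der_continuous psi_deriv.

Let cont_gpsi : continuous (fun z => g (psi z)).
Proof. exact: cont_comp. Qed.

Let cont_r : continuous r.
Proof. rewrite /r; cont. Qed.

Let k_gt0 : 0 < k.
Proof. by have /andP[h _] := k_bound; exact: lt_le_trans h. Qed.

Let eta_ge0 : 0 <= eta.
Proof. by rewrite divr_ge0 ?sqr_ge0// segint_ge0. Qed.

(** Constant when the residual vanishes; in general its derivative is [- r z / (k * g (psi z))]. *)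
Let E z := G (psi z) - k^-1 * z.

Let E_close z : 0 <= z <= tau -> `|E z - E 0| <= eta.
Proof.
move=> /andP[z0 zt].
have dE x : has_deriv E x (- (r x / (k * g (psi x)))).
  have h := der_comp (G_deriv (psi x)) (psi_deriv x).
  apply: has_deriv_eq; first by rewrite /E; der.
  by rewrite /= /r; field; rewrite !gt_eqF.
have cdE : continuous (fun x => - (r x / (k * g (psi x)))).
  have h : continuous (fun x => (k * g (psi x))^-1).
    by apply: contV; [move=> x; rewrite gt_eqF// mulr_gt0|cont].
  by cont.
rewrite -(segint_FTC z0 cdE dE); apply: le_trans (ler_norm_segint _ _ cdE) _.
have cr : continuous (fun x => `|r x|) by cont.
apply: le_trans (le_segint_sub _ _ z0 zt) _; [exact: cont_norm|by []|].
rewrite /eta mulrC -segintZ//; apply: le_segint; [exact: cont_norm|by cont|] => x _.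
rewrite normrN normrM mulrC ler_wpM2r// normfV lef_pV2 ?posrE ?exprn_gt0//.
  have /andP[Kk _] := k_bound; have /andP[Kg _] := g_bound (psi x).
  rewrite (gtr0_norm (mulr_gt0 k_gt0 (g_gt0 (psi x)))) expr2.
  by apply: ler_pM => //; exact: ltW.
by rewrite normr_gt0 mulf_neq0// gt_eqF.
Qed.

(** Over a full period [G (psi z)] increases by [period_time], so the increment of [E] compares the
    two inverse wavenumbers. *)
Let kV_close : `|limit_wavenumber^-1 - k^-1| * tau <= eta.
Proof.
have := @E_close tau; rewrite lexx tau_ge0 => /(_ isT).
rewrite /E mulr0 subr0 -{1}[tau]add0r psi_shift G_shift Tk0.
rewrite -[X in _ -> _ * X <= _](ger0_norm tau_ge0) -normrM.
by congr (is_true (`| _ | <= _)); ring.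
Qed.

Let profile_close z : 0 <= z <= tau ->
  `|psi z - profile z| <= 2 * K2 * (1 + K2 / K1) * eta.
Proof.
have q0_lip x y : `|q0 x - q0 y| <= K2 * `|x - y|.
  apply: (lipschitz_of_deriv q0_deriv) => t.
  by rewrite gtr0_norm//; have /andP[] := g_bound (q0 t).
(* If [E] were constant and [k] equal to the limit wavenumber, [psi z] would be exactly
   [travel (z + s)]. *)
pose s := limit_wavenumber * E 0.
have close z' : 0 <= z' <= tau -> `|psi z' - travel (z' + s)| <= 2 * K2 * eta.
  move=> zI; rewrite -[psi z']q0G /travel.
  apply: (le_trans (q0_lip _ _)); rewrite mulrAC mulrC ler_wpM2r ?(ltW K2_gt0)//.
  have -> : G (psi z') - (z' + s) / limit_wavenumber = (E z' - E 0) + z' * (k^-1 - limit_wavenumber^-1).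
    by rewrite /s /E; field; rewrite !gt_eqF.
  have h1 := E_close zI; rewrite (le_trans (ler_normD _ _))//.
  have : `|z' * (k^-1 - limit_wavenumber^-1)| <= eta; last by lra.
  apply: le_trans kV_close; rewrite normrM distrC mulrC ler_wpM2l//.
  by have /andP[z0 zt] := zI; rewrite ger0_norm.
(* The mean of [psi z - z] is zero, so [s - phase] is the mean of the difference bounded in
   [close]. *)
have s_close : `|s - phase| <= 2 * K2 * eta.
  have cts : continuous (fun z => travel (z + s)) by apply: cont_comp => //; cont.
  have Es : segint 0 tau (fun z => travel (z + s) - z - (psi z - z)) =
      tau * (s - phase).
    by rewrite segintB ?travel_mean ?psi_mean ?subr0//; cont.
  have bnd x : 0 <= x <= tau ->
      `|travel (x + s) - x - (psi x - x)| <= 2 * K2 * eta.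
    by move=> /close; rewrite distrC; congr (is_true (`| _ | <= _)); ring.
  have := ler_norm_segint_cst tau_ge0 _ bnd; rewrite Es subr0.
  rewrite normrM (gtr0_norm tau_gt0) mulrC ler_pM2r//.
  by apply; cont.
move=> zI; have h := close z zI.
have h2 : `|travel (z + s) - profile z| <= K2 / K1 * (2 * K2 * eta).
  apply: (@le_trans _ _ (K2 / K1 * `|s - phase|)); last first.
    by rewrite ler_wpM2l// divr_ge0// ltW.
  have -> : s - phase = z + s - (z + phase) by ring.
  apply: (lipschitz_of_deriv travel_deriv) => t.
  rewrite gtr0_norm ?divr_gt0//; have /andP[_ gK] := g_bound (travel t).
  by apply: ler_pM; rewrite ?invr_ge0 ?lef_pV2 ?posrE// ltW.
rewrite (_ : psi z - _ = (psi z - travel (z + s)) + (travel (z + s) - profile z));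
  last by ring.
apply: (le_trans (ler_normD _ _)); lra.
Qed.

(** [C] is the constant of [profile_close], [2 * pi / K1 ^+ 4] the one of [eta2]. The factors 3 come
    from squaring a sum of three terms, and [3 / K1 ^+ 2] is the direct contribution of the
    residual. *)
Definition closeness_const : R :=
  let C := 2 * K2 * (1 + K2 / K1) in
  (2 * pi) * (C ^+ 2 + 3 * ((G1 * C / K1) ^+ 2 + (K2 / (2 * pi)) ^+ 2))
     * (2 * pi / K1 ^+ 4) + 3 / K1 ^+ 2.

Definition wavenumber_const : R := K2 ^+ 4 / (2 * pi * K1 ^+ 4).

Lemma closeness_const_ge0 : 0 <= closeness_const.
Proof.
apply: addr_ge0; last by rewrite divr_ge0 ?sqr_ge0.
apply: mulr_ge0; last by apply: divr_ge0 tau_ge0 (exprn_ge0 _ (ltW K1_gt0)).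
apply: mulr_ge0 tau_ge0 _; apply: addr_ge0 (sqr_ge0 _) _.
by rewrite mulr_ge0// addr_ge0 ?sqr_ge0.
Qed.

Lemma wavenumber_const_ge0 : 0 <= wavenumber_const.
Proof.
apply: divr_ge0; first exact: exprn_ge0 (ltW K2_gt0).
exact: mulr_ge0 tau_ge0 (exprn_ge0 _ (ltW K1_gt0)).
Qed.

Let eta2 : eta ^+ 2 <= (tau / K1 ^+ 4) * rho2.
Proof.
rewrite (_ : _ * rho2 = tau * rho2 / (K1 ^+ 2) ^+ 2); last first.
  by field; rewrite gt_eqF.
rewrite /eta expr_div_n ler_wpM2r ?invr_ge0 ?sqr_ge0//.
have := segint_cauchy_schwarz tau_gt0 cont_r; rewrite subr0.
by [].
Qed.

Lemma wavenumber_stability : (k - limit_wavenumber) ^+ 2 <= wavenumber_const * rho2.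
Proof.
have /andP[_ kK] := k_bound.
have k0K : limit_wavenumber <= K2.
  rewrite /limit_wavenumber ler_pdivrMr// -/tau -ler_pdivrMl//.
  have <- : segint 0 tau (fun=> K2^-1) = K2^-1 * tau by rewrite segint_cst// subr0.
  apply: le_segint => [|//|v _]; first by cont.
  by rewrite lef_pV2 ?posrE//; have /andP[] := g_bound v.
have -> : k - limit_wavenumber = k * limit_wavenumber * (limit_wavenumber^-1 - k^-1) by field; rewrite !gt_eqF.
have h : (limit_wavenumber^-1 - k^-1) ^+ 2 * tau ^+ 2 <= (tau / K1 ^+ 4) * rho2.
  apply: le_trans eta2; rewrite -exprMn -real_normK ?num_real//.
  rewrite ler_sqr ?nnegrE//; apply: le_trans kV_close.
  by rewrite normrM (gtr0_norm tau_gt0).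
have h2 : (limit_wavenumber^-1 - k^-1) ^+ 2 <= rho2 / (tau * K1 ^+ 4).
  have -> : rho2 / (tau * K1 ^+ 4) = (tau / K1 ^+ 4) * rho2 / tau ^+ 2.
    by field; rewrite !gt_eqF.
  by rewrite ler_pdivlMr ?exprn_gt0.
rewrite (_ : wavenumber_const * _ = K2 ^+ 4 * (rho2 / (tau * K1 ^+ 4))).
  rewrite exprMn; apply: ler_pM (sqr_ge0 _) (sqr_ge0 _) _ h2.
  rewrite (_ : K2 ^+ 4 = (K2 * K2) ^+ 2); last by ring.
  rewrite ler_sqr ?nnegrE ?(ltW (mulr_gt0 _ _))//.
  by apply: ler_pM => //; exact: ltW.
by rewrite /wavenumber_const -/tau mulrA mulrAC.
Qed.

Lemma profile_stability :
  segint 0 (2 * pi) (fun z => (psi z - profile z) ^+ 2) +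
  segint 0 (2 * pi) (fun z => (dpsi z - g (profile z) / limit_wavenumber) ^+ 2) <=
    closeness_const * rho2.
Proof.
have /andP[K1k kK] := k_bound.
have cprof := der_continuous profile_deriv.
have cgp : continuous (fun z => g (profile z)) by exact: cont_comp.
rewrite /closeness_const; set C := 2 * K2 * _.
have C0 : 0 <= C by rewrite !mulr_ge0 ?(ltW K2_gt0)// addr_ge0// divr_ge0// ltW.
have G10 : 0 <= G1 := le_trans (normr_ge0 _) (dg_bound 0).
have sq (x y : R) : `|x| <= y -> x ^+ 2 <= y ^+ 2.
  move=> xy; rewrite -real_normK ?num_real// ler_sqr ?nnegrE//.
  exact: le_trans xy.
pose D := C ^+ 2 + 3 * ((G1 * C / K1) ^+ 2 + (K2 / tau) ^+ 2).
have D0 : 0 <= D by rewrite addr_ge0 ?sqr_ge0// mulr_ge0// addr_ge0 ?sqr_ge0.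
apply: (@le_trans _ _ (segint 0 tau
    (fun z => D * eta ^+ 2 + 3 / K1 ^+ 2 * r z ^+ 2))); last first.
  rewrite segintD; [|cont|cont]; rewrite segint_cst// subr0 segintZ; last by cont.
  rewrite -/rho2 [leRHS]mulrDl lerD2r -!/tau -/D.
  have := ler_wpM2l (mulr_ge0 tau_ge0 D0) eta2.
  by congr (is_true (_ <= _)); ring.
rewrite -segintD; [|cont|cont].
apply: le_segint; [cont|cont|] => z zI.
have hp := profile_close zI; rewrite -/C in hp.
have a1 := sq _ _ hp.
(* The three terms are the errors of the profile, of the equation and of the wavenumber. *)
have -> : dpsi z - g (profile z) / limit_wavenumber = (g (psi z) - g (profile z)) / k - r z / k
    + g (profile z) * (k^-1 - limit_wavenumber^-1).
  by rewrite /r; field; rewrite !gt_eqF.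
set A := _ / k; set B := r z / k; set S := _ * (_ - _).
have tri : (A - B + S) ^+ 2 <= 3 * (A ^+ 2 + B ^+ 2 + S ^+ 2).
  have := sqr_ge0 (A + B); have := sqr_ge0 (A - S); have := sqr_ge0 (B + S).
  by nra.
have kV : k^-1 <= K1^-1 by rewrite lef_pV2 ?posrE.
have hA : A ^+ 2 <= (G1 * C / K1 * eta) ^+ 2.
  apply: sq; rewrite /A normrM normfV (gtr0_norm k_gt0) mulrAC.
  apply: ler_pM => //; first by rewrite invr_ge0 ltW.
  rewrite -mulrA; apply: (le_trans (lipschitz_of_deriv g_deriv dg_bound _ _)).
  by rewrite ler_wpM2l.
have hB : B ^+ 2 <= r z ^+ 2 / K1 ^+ 2.
  rewrite /B -[r z ^+ 2]real_normK ?num_real// -expr_div_n; apply: sq.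
  by rewrite normrM normfV (gtr0_norm k_gt0) ler_wpM2l.
have hS : S ^+ 2 <= (K2 / tau * eta) ^+ 2.
  apply: sq; rewrite /S normrM distrC (gtr0_norm (g_gt0 _)) -mulrA.
  apply: ler_pM => //; first exact: ltW.
    by have /andP[] := g_bound (profile z).
  by rewrite mulrC ler_pdivlMr.
rewrite [leRHS]exprMn in a1; rewrite [leRHS]exprMn in hA.
rewrite [leRHS]exprMn in hS; rewrite /D -[3 / _ * _]mulrA [_^-1 * _]mulrC.
exact: energy_bookkeeping a1 tri hA hB hS.
Qed.

End Stability.
End LimitProfile.

(** * Convergence *)

Section PeriodicBounds.
Variable R : realType.
Implicit Types (f : R -> R) (T v : R).

Lemma periodic_int f T v (n : int) : periodic f T -> f (v - T * n%:~R) = f v.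
Proof.
move=> pf; case: n => m.
  by rewrite -[in RHS](subrK (T * m%:~R) v) -(periodicn pf m) -mulr_natr.
by rewrite NegzE mulrNz mulrN opprK -(periodicn pf m.+1 v) -mulr_natr.
Qed.

Lemma periodic_reduce f T v : 0 < T -> periodic f T ->
  exists2 w, 0 <= w <= T & f v = f w.
Proof.
move=> T0 pf; pose n := Num.floor (v / T); pose w := v - T * n%:~R.
have wI : 0 <= w <= T.
  have /andP[n1 n2] := floor_itv (v / T); rewrite -/n in n1 n2.
  rewrite intrD in n2; apply/andP; split.
    by rewrite subr_ge0 mulrC -ler_pdivlMr.
  rewrite /w lerBlDr -[X in _ <= X + _]mulr1 -mulrDr mulrC -ler_pdivrMr// addrC.
  exact: ltW.
by exists w => //; rewrite /w periodic_int.
Qed.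

Lemma periodic_min f T : 0 < T -> continuous f -> periodic f T ->
  exists w, forall v, f w <= f v.
Proof.
move=> T0 cf pf.
have [c _ Hc] := EVT_min (ltW T0) (continuous_subspaceT cf).
exists c => v; have [w wI ->] := periodic_reduce v T0 pf.
by apply: Hc; rewrite in_itv.
Qed.

Lemma periodic_max f T : 0 < T -> continuous f -> periodic f T ->
  exists w, forall v, f v <= f w.
Proof.
move=> T0 cf pf.
have [c _ Hc] := EVT_max (ltW T0) (continuous_subspaceT cf).
exists c => v; have [w wI ->] := periodic_reduce v T0 pf.
by apply: Hc; rewrite in_itv.
Qed.

Lemma smooth_derivable f n x : smooth f -> has_deriv (derive1n n f) x (derive1n n.+1 f x).
Proof. by move=> sf; split; [exact: sf|rewrite derive1nS derive1E]. Qed.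

End PeriodicBounds.

Section ClassicalH1.
Variable R : realType.
Implicit Types (f df : R -> R).

Lemma sqnormL2_continuous f : continuous f ->
  sqnormL2 f = (segint 0 (2 * pi) (fun z => f z ^+ 2))%:E.
Proof.
move=> cf; rewrite /sqnormL2 /segint /Rintegral fineK//.
by apply: integrable_fin_num => //; apply: continuous_integrable; cont.
Qed.

Lemma inL2_continuous f : continuous f -> inL2 f.
Proof.
move=> cf; split; last by rewrite sqnormL2_continuous// ltry.
have /integrableP[mf _] := continuous_integrable 0 (2 * pi) cf.
by apply/measurable_realfun.measurable_EFinP; exact: mf.
Qed.

Lemma H1per_with_classical f df : (forall z, has_deriv f z (df z)) ->
  continuous df -> periodic f (2 * pi) -> H1per_with f df.
Proof.
move=> fd cdf pf; have cf := der_continuous fd.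
split; [by []|exact: inL2_continuous|exact: inL2_continuous|].
move=> eta seta peta.
have etad x := smooth_derivable 0 x seta.
have cdeta := der_continuous (fun x => smooth_derivable 1 x seta).
rewrite derive1n0 in etad; rewrite derive1n1 in cdeta; rewrite derive1n1 in etad.
have t0 : 0 <= 2 * pi :> R by rewrite mulr_ge0// pi_ge0.
have := segint_by_parts t0 cdf cdeta fd etad.
by rewrite -[X in f X]add0r -[X in eta X]add0r pf peta subrr sub0r.
Qed.

End ClassicalH1.

Section InverseDecay.
Variable R : realType.
Implicit Types (F : R -> R) (l B : R).

Lemma cvg_of_sqr_le F l B :
  (forall c, 0 < c -> (F c - l) ^+ 2 <= B / c) -> F c @[c --> +oo] --> l.
Proof.
move=> H; apply/cvgrPdist_le => e e0.
exists (Num.max 0 (B / e ^+ 2)); split; first exact: num_real.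
move=> c; rewrite gt_max => /andP[c0 Bc].
rewrite distrC -ler_sqr ?nnegrE ?(ltW e0)// real_normK ?num_real//.
apply: le_trans (H c c0) _; rewrite ler_pdivrMr// -ler_pdivrMl ?exprn_gt0//.
by rewrite mulrC ltW.
Qed.

Lemma cvg_of_le F B :
  (forall c, 0 < c -> 0 <= F c <= B / c) -> F c @[c --> +oo] --> (0 : R).
Proof.
move=> H; apply/cvgrPdist_le => e e0.
exists (Num.max 0 (B / e)); split; first exact: num_real.
move=> c; rewrite gt_max => /andP[c0 Bc]; have /andP[F0 FB] := H c c0.
rewrite sub0r normrN ger0_norm//; apply: le_trans FB _.
by rewrite ler_pdivrMr// -ler_pdivrMl// mulrC ltW.
Qed.

End InverseDecay.

(* [K cx] is K_x(k_y, c_x) and [phi cx] is the corresponding solution. *)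
Theorem mainTheorem3 (R : realType) (g : R -> R) (ky : R)
    (g_smooth : smooth g) (g_periodic : periodic g (2 * pi))
    (g_pos : forall v : R, 0 < g v) (ky_gt0 : 0 < ky)
    (K : R -> R) (phi : R -> R -> R -> R)
    (phi_sol : forall cx : R, 0 <= cx ->
       monotone_solution g ky cx (K cx) (phi cx)) :
  K cx @[cx --> +oo] --> harmonic_average g /\
  exists2 psi0 : R -> R,
    unique (limit_profile g) psi0 &
    cvg_H1per (fun cx z => phi cx 0 z - z) (fun z => psi0 z - z).
Proof.
have p0 := @pi_gt0 R; have t0 : 0 < 2 * pi :> R by rewrite mulr_gt0.
pose dg := derive1 g.
have g_deriv v : has_deriv g v (dg v) by have := smooth_derivable 0 v g_smooth.
have cdg : continuous dg.
  exact: (der_continuous (fun x => smooth_derivable 1 x g_smooth)).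
have cg := der_continuous g_deriv.
have [w1 g_min] := periodic_min t0 cg g_periodic.
have [w2 g_max] := periodic_max t0 cg g_periodic.
have [w3 dg_max] := periodic_max t0 (cont_norm cdg) (fun v =>
  congr1 (fun y => `|y|) (periodic_deriv g_deriv g_periodic v)).
set K1 := g w1 in g_min; set K2 := g w2 in g_max.
(* [K1], [K2] and [G1] depend on [g] alone, so all later constants are independent of [c]. *)
set G1 := `|dg w3| in dg_max.
have K10 : 0 < K1 by exact: g_pos.
have gK v : K1 <= g v <= K2 by rewrite g_min g_max.
have cgV : continuous (fun v => (g v)^-1) by apply: contV => // v; rewrite gt_eqF.
have [G G_deriv] := primitive_exists cgV.
have gV v : K2^-1 <= (g v)^-1.
  by rewrite lef_pV2 ?posrE ?g_pos//; have /andP[] := gK v.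
have K2V : 0 < K2^-1 by rewrite invr_gt0 g_pos.
have [q0 Gq0] := right_inverse_exists K2V G_deriv gV.
pose kk := limit_wavenumber g; pose psi0 := profile g q0.
pose dpsi0 z := g (psi0 z) / kk.
have kE : harmonic_average g = kk by rewrite /harmonic_average [LHS]invfM invrK.
have kk_gt0 : 0 < kk by exact: (limit_wavenumber_gt0 g_deriv K10 gK).
have psi0_deriv z : has_deriv psi0 z (dpsi0 z).
  by exact: (profile_deriv K10 gK G_deriv Gq0).
have psi0_shift z : psi0 (z + 2 * pi) = psi0 z + 2 * pi.
  by exact: (profile_shift g_deriv g_periodic K10 gK G_deriv Gq0).
have cpsi0 := der_continuous psi0_deriv.
have cdpsi0 : continuous dpsi0.
  have cgp : continuous (fun z => g (psi0 z)) by exact: cont_comp.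
  by rewrite /dpsi0; cont.
pose psi c := phi c 0; pose dpsi c := dz (phi c) 0.
pose rho2 c := segint 0 (2 * pi) (fun z => (g (psi c z) - K c * dpsi c z) ^+ 2).
pose W := multiplier_const ky K1 K2 * (2 * (G1 * (2 * pi)) ^+ 2).
have rho2_le c : 0 < c -> rho2 c <= (W / pi) / c.
  move=> c0; have := residual_estimate g_deriv cdg g_periodic K10 gK dg_max
    ky_gt0 c0 (phi_sol c (ltW c0)).
  by rewrite -/(rho2 c) -/W -ler_pdivlMl// mulrCA mulrA.
have psi_der c : 0 < c -> forall z, has_deriv (psi c) z (dpsi c z).
  by move=> c0; exact: (psi_deriv (phi_sol c (ltW c0))).
have cdpsi c : 0 < c -> continuous (dpsi c).
  by move=> c0; exact: (cont_dpsi (phi_sol c (ltW c0))).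
have psi_sh c : 0 < c -> forall z, psi c (z + 2 * pi) = psi c z + 2 * pi.
  by move=> c0; exact: (psi_shift (phi_sol c (ltW c0))).
have psi_me c : 0 < c -> segint 0 (2 * pi) (fun z => psi c z - z) = 0.
  by move=> c0; exact: (psi_mean c0 (phi_sol c (ltW c0))).
have K_bd c : 0 < c -> K1 <= K c <= K2.
  by move=> c0; exact: (wavenumber_bound g_deriv gK c0 (phi_sol c (ltW c0))).
(* The weak derivatives used as witnesses are the classical ones, for the solutions and for the
   limit alike. *)
have displacement (f df : R -> R) : (forall z, has_deriv f z (df z)) ->
    continuous df -> (forall z, f (z + 2 * pi) = f z + 2 * pi) ->
    H1per_with (fun z => f z - z) (fun z => df z - 1).
  move=> fd cdf fs; apply: H1per_with_classical; [|by cont|].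
    by move=> z; have h := fd z; apply: has_deriv_eq; [der|].
  by move=> z; rewrite fs; ring.
split.
  rewrite kE; apply: (@cvg_of_sqr_le _ _ _ (wavenumber_const K1 K2 * (W / pi))).
  move=> c c0; apply: le_trans (wavenumber_stability g_deriv g_periodic K10 gK
    G_deriv (psi_der c c0) (cdpsi c c0) (psi_sh c c0) (K_bd c c0)) _.
  rewrite -[leRHS]mulrA ler_wpM2l ?rho2_le//.
  exact: (wavenumber_const_ge0 K10 gK).
exists psi0.
  split.
    split.
    - by move=> z; have [] := psi0_deriv z.
    - move=> z; rewrite kE derive1E; have [_ ->] := psi0_deriv z.
      by rewrite /dpsi0 mulrC divfK// gt_eqF.
    - exact: psi0_shift.
    - by exact: (profile_mean g_deriv g_periodic K10 gK G_deriv Gq0).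
  move=> f [fd ode fs fm]; apply/esym; apply: (profile_unique g_deriv g_periodic K10 gK G_deriv Gq0 _ _ fm).
  - by move=> z; split; [exact: fd|reflexivity].
  - by move=> z; have := ode z; rewrite kE derive1E.
exists (fun c z => dpsi c z - 1), (fun z => dpsi0 z - 1); split.
- exists 0; split; first exact: num_real.
  by move=> c c0; apply: displacement; [exact: psi_der|exact: cdpsi|exact: psi_sh].
- exact: displacement.
pose F c := segint 0 (2 * pi) (fun z => (psi c z - psi0 z) ^+ 2) +
  segint 0 (2 * pi) (fun z => (dpsi c z - dpsi0 z) ^+ 2).
have F0 : F c @[c --> +oo] --> (0 : R).
  apply: (@cvg_of_le _ _ (closeness_const K1 K2 G1 * (W / pi))) => c c0.
  apply/andP; split.
    by rewrite addr_ge0// segint_ge0// => z _; exact: sqr_ge0.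
  apply: le_trans (profile_stability g_deriv g_periodic K10 gK dg_max G_deriv Gq0
    (psi_der c c0) (cdpsi c c0) (psi_sh c c0) (psi_me c c0) (K_bd c c0)) _.
  rewrite -[leRHS]mulrA ler_wpM2l ?rho2_le//.
  exact: closeness_const_ge0.
(* For [c > 0] all functions are continuous, so the extended-real norms are finite and convergence
   reduces to that of [F]. *)
have FE : \forall c \near +oo, (sqnormL2 (fun z => psi c z - z - (psi0 z - z))%R
    + sqnormL2 (fun z => dpsi c z - 1 - (dpsi0 z - 1))%R)%E = (F c)%:E.
  exists 0; split; first exact: num_real.
  move=> c c0; have cp := der_continuous (psi_der c c0); have cd := cdpsi c c0.
  rewrite !sqnormL2_continuous; [|by cont|by cont].
  by rewrite -EFinD /F; congr (_ + _)%:E; apply: eq_segint => z _;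
    congr (_ ^+ 2); ring.
apply: cvg_EFin.
  by apply: filterS FE => c ->.
apply: cvg_trans F0; apply: near_eq_cvg.
by apply: filterS FE => c /= ->.
Qed.
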